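(* Let $f:\mathbb{D}\to\mathbb{D}$ be holomorphic. Suppose that there is a point $a\in\mathbb{D}$ such that $f^{\circ n}\to a$ locally uniformly on $\mathbb{D}$. Then, for every trace-class operator $\rho\in\mathcal{S}_1(H^2)$, $$\lim_{n\to\infty}\big\|\Phi_{f,*}^{n}(\rho)-\mathrm{Tr}(\rho)\rho_a\big\|_1=0,\qquad\text{where }\ \rho_a=|\widetilde k_a\rangle\langle\widetilde k_a|,\quad \widetilde k_a=\frac{k_a}{\|k_a\|}.$$ Consequently, for every $S\in B(H^2)$, $$\Phi_f^{n}(S)\longrightarrow\langle\widetilde k_a,S\widetilde k_a\rangle_{H^2}\,I$$ in the ultraweak topology as $n\to\infty$.
   Context: All inner products are linear in the second variable. $\mathbb{D}$ is the open unit disk, $H^2$ its Hardy space with Szegő kernel $k(z,w)=\frac{1}{1-z\overline w}$, $k_w=k(\cdot,w)$, so $h(w)=\langle k_w,h\rangle$ for $h\in H^2$. $f^{\circ n}$ is the $n$-fold composition of $f$ with itself. $\mathcal{S}_1(H^2)$ is the space of trace-class operators on $H^2$ with trace norm $\|\cdot\|_1$; $|x\rangle\langle y|$ is the operator $h\mapsto x\langle y,h\rangle$. The kernel $c_f(z,w)=\frac{1-f(z)\overline{f(w)}}{1-z\overline w}$ is positive definite on $\mathbb{D}$; its reproducing kernel Hilbert space is the de Branges-Rovnyak space $\mathcal{H}(f)$, and $c_{f,w}=c_f(\cdot,w)$. $V_f:H^2\to H^2\otimes\mathcal{H}(f)$ is the isometry determined by $V_fk_w=k_{f(w)}\otimes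 c_{f,w}$, $w\in\mathbb{D}$, and $\Phi_f(S)=V_f^{*}(S\otimes I_{\mathcal{H}(f)})V_f$ for $S\in B(H^2)$, a normal unital completely positive map. Its preadjoint $\Phi_{f,*}$ is the map on $\mathcal{S}_1(H^2)$ with $\mathrm{Tr}(\Phi_{f,*}(\rho)S)=\mathrm{Tr}(\rho\,\Phi_f(S))$; $\Phi_f^n$ and $\Phi_{f,*}^n$ denote $n$-fold iterates. *)

(* Defs.v *)
From HB Require Import structures.
From mathcomp Require Import all_boot all_order all_algebra.
From mathcomp Require Import complex.
From mathcomp Require Import all_classical all_reals all_analysis.
From mathcomp Require Import ring lra.

Set Implicit Arguments.
Unset Strict Implicit.
Unset Printing Implicit Defensive.
Import Order.TTheory GRing.Theory Num.Theory.
Import numFieldNormedType.Exports.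
Local Open Scope classical_set_scope.
Local Open Scope ring_scope.

(* [R[i]^o] is [R[i]] with the topology given by the modulus. *)
Notation cplx R := ((R[i])%C^o).

(* The norm [`|x|] of a normed module over [R[i]] takes values in [R[i]]. The
   inner product is linear in the second variable. *)
HB.mixin Record CompleteNormedModule_isHilbert (R : realType) (H : Type)
    & CompleteNormedModule R[i]%C H := {
  ip : H -> H -> R[i]%C ;
  ip_linear : forall x, linear_for *%R (ip x) ;
  ip_conj : forall x y, ip y x = (ip x y)^* ;
  ip_norm : forall x, ip x x = `|x| ^+ 2
}.

#[short(type="hilbertType")]
HB.structure Definition Hilbert (R : realType) :=
  { H of CompleteNormedModule R[i]%C H & CompleteNormedModule_isHilbert R H }.

Section Operators.
Context {R : realType}.

Definition bounded_op (H K : hilbertType R) (A : H -> K) : Prop :=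
  linear A /\ continuous A.

Definition linear_isometry (H K : hilbertType R) (V : H -> K) : Prop :=
  linear V /\ forall x, `|V x| = `|x|.

Definition adjoint (H K : hilbertType R) (A : H -> K) : K -> H :=
  xget (cst 0) [set B | forall x y, ip (B y) x = ip y (A x)].

Definition ketbra (H : hilbertType R) (x y : H) : H -> H :=
  fun h => ip y h *: x.

(* [|A| = (A^* A)^{1/2}]. *)
Definition op_abs (H : hilbertType R) (A : H -> H) : H -> H :=
  xget (cst 0) [set P | [/\ bounded_op P, forall x, 0 <= ip x (P x)
                          & P \o P = adjoint A \o A]].

Record hilbert_tensor (H K : hilbertType R) := HilbertTensor {
  tens_space :> hilbertType R ;
  tens : H -> K -> tens_space ;
  tens_linearl : forall y, linear (tens^~ y) ;
  tens_linearr : forall x, linear (tens x) ;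
  ip_tens : forall x y x' y',
    ip (tens x y) (tens x' y') = ip x x' * ip y y' ;
  tens_dense : closure [set u : tens_space |
    exists n (x : 'I_n -> H) (y : 'I_n -> K), u = \sum_i tens (x i) (y i)]
    = setT
}.

(* [S (x) I]. *)
Definition ampl (H K : hilbertType R) (T : hilbert_tensor H K)
    (S : H -> H) : T -> T :=
  xget (cst 0) [set W | bounded_op W /\
                        forall x y, W (tens T x y) = tens T (S x) y].

(* A Hilbert space of functions on [D] whose reproducing kernel is [k]; only
   the values on [D] of [rk_eval h] are meaningful. *)
Record rkhs (D : set (cplx R)) (k : cplx R -> cplx R -> cplx R) := Rkhs {
  rk_space :> hilbertType R ;
  rk_eval : rk_space -> cplx R -> cplx R ;
  rk_eval_linear : forall z, D z -> linear_for *%R (rk_eval^~ z) ;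
  rk_eval_inj : forall g h,
    (forall z, D z -> rk_eval g z = rk_eval h z) -> g = h ;
  rk_ker : cplx R -> rk_space ;
  rk_kerE : forall w z, D w -> D z -> rk_eval (rk_ker w) z = k z w ;
  rk_reproducing : forall w h, D w -> rk_eval h w = ip (rk_ker w) h
}.

Definition disk : set (cplx R) := [set z | `|z| < 1].

Definition locally_uniformly (D : set (cplx R)) (g : nat -> cplx R -> cplx R)
    (l : cplx R -> cplx R) : Prop :=
  forall z, D z -> exists2 U, nbhs z U & {uniform U `&` D, g @ \oo --> l}.

End Operators.

(* The Hardy space, a function [h] being represented by the sequence of its
   Taylor coefficients at 0. *)
Section Hardy.
Context {R : realType}.
Implicit Types (u v : nat -> cplx R) (z w : cplx R).

Definition sqmod z : R := complex.Re (`|z| ^+ 2).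

Definition square_summable : pred (nat -> cplx R) :=
  fun u => `[< cvgn (series (fun n => sqmod (u n))) >].

Lemma normC2 z :
  `|z| ^+ 2 = (complex.Re z ^+ 2 + complex.Im z ^+ 2)%:C%C :> R[i]%C.
Proof.
by rewrite normc_def -rmorphXn sqr_sqrtr // addr_ge0 // sqr_ge0.
Qed.

Lemma sqmodE z : sqmod z = complex.Re z ^+ 2 + complex.Im z ^+ 2.
Proof. by rewrite /sqmod normC2. Qed.

Lemma norm_sqmod z : `|z| ^+ 2 = (sqmod z)%:C%C.
Proof. by rewrite sqmodE normC2. Qed.

Lemma sqmod_ge0 z : 0 <= sqmod z.
Proof. by rewrite sqmodE addr_ge0 // sqr_ge0. Qed.

Lemma sqmod_eq0 z : sqmod z = 0 -> z = 0.
Proof.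
move=> z0; have : `|z| ^+ 2 = 0 by rewrite norm_sqmod z0.
by move/eqP; rewrite sqrf_eq0 normr_eq0 => /eqP.
Qed.

Lemma sqmodM z w : sqmod (z * w) = sqmod z * sqmod w.
Proof. by rewrite !sqmodE; case: z w => a b [c d] /=; ring. Qed.

Lemma sqmodD_le (t : R) z w : 0 < t ->
  sqmod (z + w) <= (1 + t) * sqmod z + (1 + t^-1) * sqmod w.
Proof.
move=> t0; rewrite !sqmodE; case: z w => a b [c d] /=.
have H (x y : R) : (x + y) ^+ 2 <= (1 + t) * x ^+ 2 + (1 + t^-1) * y ^+ 2.
  rewrite -subr_ge0.
  have -> : (1 + t) * x ^+ 2 + (1 + t^-1) * y ^+ 2 - (x + y) ^+ 2 =
     t^-1 * (t * x - y) ^+ 2.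
    by field; rewrite gt_eqF.
  by rewrite mulr_ge0 ?invr_ge0 ?sqr_ge0 // ltW.
by have := H a c; have := H b d; lra.
Qed.

Definition psum u (n : nat) : R := series (fun k => sqmod (u k)) n.

Lemma psum_nd u : nondecreasing_seq (psum u).
Proof. by apply: nondecreasing_series => n _ _; exact: sqmod_ge0. Qed.

Lemma square_summableP u : reflect
  (exists M, forall n, psum u n <= M) (u \in square_summable).
Proof.
apply: (iffP idP) => [/asboolP cu|[M uM]].
  exists (limn (psum u)) => n.
  exact: nondecreasing_cvgn_le (@psum_nd u) cu n.
apply/asboolP; apply: nondecreasing_is_cvgn; first exact: psum_nd.
by exists M => _ /= [n _ <-]; exact: uM.
Qed.

Lemma square_summable_submod : submod_closed square_summable.
Proof.
split=> [|c u v /square_summableP[M uM] /square_summableP[N vN]].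
  apply/square_summableP; exists 0 => n; rewrite /psum /series /=.
  by rewrite big1 // => i _; rewrite sqmodE /= expr0n /= addr0.
apply/square_summableP.
exists (2 * (sqmod c * M) + 2 * N) => n; rewrite /psum /series /=.
apply: le_trans (_ : \sum_(0 <= k < n)
   (2 * (sqmod c * sqmod (u k)) + 2 * sqmod (v k)) <= _).
  apply: ler_sum => i _; rewrite -sqmodM.
  have := @sqmodD_le 1 (c * u i) (v i) ltr01.
  by rewrite invr1.
rewrite big_split /= -!mulr_sumr.
have := uM n; have := vN n; rewrite /psum /series /= => h1 h2.
apply: lerD; last by rewrite ler_pM2l.
by rewrite ler_pM2l // ler_wpM2l // sqmod_ge0.
Qed.

HB.instance Definition _ := GRing.isSubmodClosed.Build R[i]%C
  (nat -> cplx R) square_summable square_summable_submod.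

Record hardy := Hardy { taylor : nat -> cplx R ; _ : taylor \in square_summable }.

HB.instance Definition _ := [isSub for taylor].
HB.instance Definition _ := [Choice of hardy by <:].
HB.instance Definition _ :=
  [SubChoice_isSubLmodule of hardy by <:].

Implicit Types g h : hardy.

Lemma taylorD g h n : taylor (g + h) n = taylor g n + taylor h n.
Proof. by []. Qed.

Lemma taylorZ (c : R[i]%C) h n : taylor (c *: h) n = c * taylor h n.
Proof. by []. Qed.

Lemma taylorB g h n : taylor (g - h) n = taylor g n - taylor h n.
Proof. by []. Qed.

Definition sqnorm h : R := limn (psum (taylor h)).

Lemma psum_cvg h : psum (taylor h) n @[n --> \oo] --> sqnorm h.
Proof. by have /asboolP := valP h. Qed.

Lemma psum_le h n : psum (taylor h) n <= sqnorm h.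
Proof.
apply: nondecreasing_cvgn_le; first exact: psum_nd.
by apply/cvg_ex; exists (sqnorm h); exact: psum_cvg.
Qed.

Lemma sqnorm_le h (M : R) :
  (forall n, psum (taylor h) n <= M) -> sqnorm h <= M.
Proof.
move=> hM; apply: limr_le.
  by apply/cvg_ex; exists (sqnorm h); exact: psum_cvg.
by apply: nearW.
Qed.

Lemma sqmod_le_sqnorm h n : sqmod (taylor h n) <= sqnorm h.
Proof.
apply: le_trans (psum_le h n.+1).
rewrite /psum /series /= big_nat_recr //= lerDr.
by apply: sumr_ge0 => i _; exact: sqmod_ge0.
Qed.

Lemma sqnorm_ge0 h : 0 <= sqnorm h.
Proof. exact: le_trans (sqmod_ge0 _) (sqmod_le_sqnorm h 0). Qed.

Lemma sqnormZ (c : R[i]%C) h : sqnorm (c *: h) = sqmod c * sqnorm h.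
Proof.
apply: cvg_lim; first exact: norm_hausdorff.
have -> : psum (taylor (c *: h)) = (fun n => sqmod c * psum (taylor h) n).
  apply/funext => n; rewrite /psum /series /= mulr_sumr.
  by apply: eq_bigr => i _; rewrite -sqmodM.
by apply: cvgM; [exact: cvg_cst | exact: psum_cvg].
Qed.

Lemma sqnormD_le (t : R) g h : 0 < t ->
  sqnorm (g + h) <= (1 + t) * sqnorm g + (1 + t^-1) * sqnorm h.
Proof.
move=> t0; apply: sqnorm_le => n.
apply: le_trans (_ : (1 + t) * psum (taylor g) n +
    (1 + t^-1) * psum (taylor h) n <= _); last first.
  by apply: lerD; rewrite ler_pM2l ?psum_le // addr_gt0 // invr_gt0.
rewrite /psum /series /= !mulr_sumr -big_split /=.
by apply: ler_sum => i _; exact: sqmodD_le.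
Qed.

Definition hnorm h : R[i]%C := (Num.sqrt (sqnorm h))%:C%C.

Lemma hnormD g h : hnorm (g + h) <= hnorm g + hnorm h.
Proof.
rewrite /hnorm -rmorphD lecR; set p := Num.sqrt (sqnorm g).
set q := Num.sqrt (sqnorm h).
have p0 : 0 <= p by exact: sqrtr_ge0.
have q0 : 0 <= q by exact: sqrtr_ge0.
apply/ler_addgt0Pr => e e0.
set a := p + e / 2; set b := q + e / 2.
have a0 : 0 < a by rewrite /a; lra.
have b0 : 0 < b by rewrite /b; lra.
have -> : p + q + e = a + b by rewrite /a /b; field.
have ab0 : 0 <= a + b by rewrite addr_ge0 // ltW.
rewrite -(ger0_norm ab0) -sqrtr_sqr ler_wsqrtr //.
apply: le_trans (_ : (1 + b / a) * a ^+ 2 + (1 + (b / a)^-1) * b ^+ 2 <= _).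
  apply: le_trans (sqnormD_le g h (_ : 0 < b / a)) _; first exact: divr_gt0.
  apply: lerD; rewrite ler_pM2l ?addr_gt0 ?invr_gt0 ?divr_gt0 //.
    rewrite -(sqr_sqrtr (sqnorm_ge0 g)) -/p.
    by rewrite ler_pXn2r ?nnegrE // ?ltW // /a; lra.
  rewrite -(sqr_sqrtr (sqnorm_ge0 h)) -/q.
  by rewrite ler_pXn2r ?nnegrE // ?ltW // /b; lra.
by rewrite le_eqVlt; apply/orP; left; apply/eqP; field; rewrite !gt_eqF.
Qed.

Lemma hnormZ (c : R[i]%C) h : hnorm (c *: h) = `|c| * hnorm h.
Proof.
rewrite /hnorm sqnormZ sqrtrM ?sqmod_ge0 // rmorphM /=; congr (_ * _).
by rewrite normc_def sqmodE.
Qed.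

Lemma hnorm_eq0 h : hnorm h = 0 -> h = 0.
Proof.
move=> /(congr1 (@complex.Re R)) /= /eqP; rewrite sqrtr_eq0 => h0.
apply: val_inj; apply/funext => n /=; apply: sqmod_eq0; apply/eqP.
by rewrite eq_le sqmod_ge0 andbT (le_trans (sqmod_le_sqnorm h n)).
Qed.

HB.instance Definition _ := @Lmodule_isNormed.Build R[i]%C hardy
  hnorm hnormD hnormZ hnorm_eq0.

Lemma hardy_normE h : `|h| = (Num.sqrt (sqnorm h))%:C%C.
Proof. by []. Qed.


Lemma gt0_complexE (e : R[i]%C) : 0 < e ->
  0 < complex.Re e /\ e = (complex.Re e)%:C%C.
Proof.
by case: e => a b; rewrite ltcE /= => /andP[/eqP -> a0].
Qed.

Lemma hardy_norm_lt h (e : R) : 0 < e ->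
  (`|h| < e%:C%C) = (sqnorm h < e ^+ 2).
Proof.
move=> e0; rewrite hardy_normE ltcR -[in RHS](sqr_sqrtr (sqnorm_ge0 h)).
by rewrite ltr_pXn2r ?nnegrE ?sqrtr_ge0 // ltW.
Qed.

Lemma hardy_complete (F : set_system hardy) :
  ProperFilter F -> cauchy F -> cvg F.
Proof.
move=> FF /cauchyP Fc.
have key (e : R) : 0 < e -> exists x, F [set y | sqnorm (x - y) < e ^+ 2].
  move=> e0; have [|x Fx] := Fc e%:C%C; first by rewrite ltcR.
  exists x; apply: filterS Fx => y; rewrite -ball_normE /=.
  by rewrite /ball_ /= hardy_norm_lt.
have coord (p : R[i]%C -> R) n : (forall z w, p (z - w) = p z - p w) ->
    (forall z, p z ^+ 2 <= sqmod z) ->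
    exists l : R, p (taylor y n) @[y --> F] --> l.
  move=> pB p2; apply/cvg_ex; apply: R_complete.
  apply: cauchy_exP => e e0; have [x Fx] := key e e0.
  exists (p (taylor x n)).
  rewrite /nbhs /=; apply: (@filterS _ F FF _ _ _ Fx) => y /= xy.
  rewrite -ball_normE /ball_ /=.
  rewrite (_ : _ - _ = p (taylor (x - y) n)); last by rewrite -pB.
  rewrite -(@ltr_pXn2r _ 2) ?nnegrE ?normr_ge0 ?(ltW e0) // real_normK ?num_real //.
  exact: le_lt_trans (le_trans (p2 _) (sqmod_le_sqnorm _ n)) xy.
have cRe n : exists l : R, complex.Re (taylor y n) @[y --> F] --> l.
  apply: coord => [[a b] [c d]//|z].
  by rewrite sqmodE lerDl sqr_ge0.
have cIm n : exists l : R, complex.Im (taylor y n) @[y --> F] --> l.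
  apply: coord => [[a b] [c d]//|z].
  by rewrite sqmodE lerDr sqr_ge0.
have [lr lrP] := choice cRe; have [li liP] := choice cIm.
pose l n : cplx R := Complex (lr n) (li n).
have psc x N : psum (taylor (x - y)) N @[y --> F] -->
    psum (fun n => taylor x n - l n) N.
  elim: N => [|N IH].
    rewrite /psum /series /= big_geq //.
    under eq_fun do rewrite big_geq //.
    exact: cvg_cst.
  rewrite /psum /series /= big_nat_recr //=.
  under eq_fun do rewrite big_nat_recr //=.
  apply: cvgD; first exact: IH.
  rewrite sqmodE; under eq_fun do rewrite sqmodE.
  have cr : complex.Re (taylor (x - y) N) @[y --> F] -->
      complex.Re (taylor x N - l N).
    rewrite (_ : (fun y => _) =
        (fun y => complex.Re (taylor x N) - complex.Re (taylor y N))).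
      by rewrite raddfB /=; apply: cvgB; [exact: cvg_cst | exact: lrP].
    by apply/funext => y; rewrite taylorB raddfB.
  have ci : complex.Im (taylor (x - y) N) @[y --> F] -->
      complex.Im (taylor x N - l N).
    rewrite (_ : (fun y => _) =
        (fun y => complex.Im (taylor x N) - complex.Im (taylor y N))).
      by rewrite raddfB /=; apply: cvgB; [exact: cvg_cst | exact: liP].
    by apply/funext => y; rewrite taylorB raddfB.
  by apply: cvgD; apply: cvgM; [exact: cr|exact: cr|exact: ci|exact: ci].
have psl x (M : R) N : F [set y | sqnorm (x - y) < M] ->
    psum (fun n => taylor x n - l n) N <= M.
  move=> Fx; rewrite -(cvg_lim (@norm_hausdorff _ _) (psc x N)).
  apply: limr_le; first by apply/cvg_ex; eexists; exact: psc.
  apply: filterS Fx => y /= xy; apply/ltW; exact: le_lt_trans (psum_le _ _) xy.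
have [x Fx] := key 1 ltr01.
have dP : (fun n => taylor x n - l n) \in square_summable.
  by apply/square_summableP; eexists => N; exact: psl Fx.
pose hl := x - Hardy dP.
have hlE n : taylor hl n = l n.
  by rewrite taylorB /= opprB addrC subrK.
apply/cvg_ex; exists hl; apply/cvgrPdist_lt => e /gt0_complexE[].
set r := complex.Re e => r0 ->.
have r20 : 0 < r / 2 by rewrite divr_gt0.
have [z Fz] := key (r / 2) r20.
apply: (@filterS _ F FF _ _ _ Fz) => y /= zy.
rewrite (_ : r%:C%C = (r / 2)%:C%C + (r / 2)%:C%C); last first.
  by rewrite -rmorphD /=; congr (_%:C%C); field.
rewrite (_ : hl - y = - (z - hl) + (z - y)); last first.
  by rewrite opprB addrA subrK.
apply: le_lt_trans (ler_normD _ _) _; rewrite normrN.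
apply: ler_ltD; last by rewrite hardy_norm_lt.
rewrite hardy_normE lecR -(ger0_norm (ltW r20)) -sqrtr_sqr ler_wsqrtr //.
apply: sqnorm_le => N; apply: le_trans (psl z _ N Fz).
rewrite le_eqVlt; apply/orP; left; apply/eqP.
by apply: eq_bigr => n _; rewrite taylorB hlE.
Qed.

HB.instance Definition _ := @Uniform_isComplete.Build hardy hardy_complete.

Lemma cvg_ReIm (T : Type) (F : set_system T) (FF : Filter F)
    (f : T -> cplx R) (l : cplx R) :
  complex.Re (f x) @[x --> F] --> complex.Re l ->
  complex.Im (f x) @[x --> F] --> complex.Im l ->
  f x @[x --> F] --> l.
Proof.
move=> /cvgrPdist_lt fr /cvgrPdist_lt fi; apply/cvgrPdist_lt => e /gt0_complexE[].
set r := complex.Re e => r0 ->.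
have r20 : 0 < r / 2 by rewrite divr_gt0.
apply: filterS2 (fr _ r20) (fi _ r20) => x xr xi.
rewrite normc_def ltcR -(ger0_norm (ltW r0)) -sqrtr_sqr ltr_sqrt ?exprn_gt0 //.
rewrite !raddfB /=.
have h (u : R) : `|u| < r / 2 -> u ^+ 2 < (r / 2) ^+ 2.
  move=> ur; rewrite -(real_normK (num_real u)) ltr_pXn2r ?nnegrE //.
  exact: ltW.
apply: lt_le_trans (ltrD (h _ xr) (h _ xi)) _.
have := sqr_ge0 r; lra.
Qed.

Definition hardy_ip g h : R[i]%C :=
  limn (series (fun n => (taylor g n)^* * taylor h n : cplx R)).

Lemma abs_cvg (u : nat -> R) (v : nat -> R) :
  (forall n, `|u n| <= v n) -> cvgn (series v) -> cvgn (series u).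
Proof.
move=> uv cv; apply: normed_cvg; apply: series_le_cvg cv => // n.
  exact: normr_ge0.
exact: le_trans (normr_ge0 (u n)) (uv n).
Qed.

Lemma hardy_ip_cvg g h :
  series (fun n => (taylor g n)^* * taylor h n : cplx R) n @[n --> \oo]
    --> (hardy_ip g h : cplx R).
Proof.
set u := (fun n => (taylor g n)^* * taylor h n : cplx R).
have cgh : cvgn (series (fun n => sqmod (taylor g n) + sqmod (taylor h n))).
  have -> : series (fun n => sqmod (taylor g n) + sqmod (taylor h n)) =
      (fun n => psum (taylor g) n + psum (taylor h) n).
    by apply/funext => n; rewrite /psum /series /= big_split.
  apply/cvg_ex; exists (sqnorm g + sqnorm h).
  by apply: cvgD; exact: psum_cvg.
have bnd (a b c d : R) : `|a * c + b * d| <= a ^+ 2 + b ^+ 2 + (c ^+ 2 + d ^+ 2).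
  rewrite ler_norml; have := sqr_ge0 (a + c); have := sqr_ge0 (b + d).
  have := sqr_ge0 (a - c); have := sqr_ge0 (b - d).
  have := sqr_ge0 a; have := sqr_ge0 b; have := sqr_ge0 c; have := sqr_ge0 d.
  by move=> *; apply/andP; split; nra.
have cr : cvgn (series (fun n => complex.Re (u n))).
  apply: abs_cvg cgh => n; rewrite /u !sqmodE.
  case: (taylor g n) (taylor h n) => a b [c d] /=.
  by rewrite mulNr opprK; exact: bnd.
have ci : cvgn (series (fun n => complex.Im (u n))).
  apply: abs_cvg cgh => n; rewrite /u !sqmodE.
  case: (taylor g n) (taylor h n) => a b [c d] /=.
  have := bnd a (- b) d c; rewrite sqrrN => H.
  by rewrite [c ^+ 2 + _]addrC.
move/cvg_ex: cr => [lr lrP]; move/cvg_ex: ci => [li liP].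
have : series u n @[n --> \oo] --> (Complex lr li : cplx R).
  apply: cvg_ReIm => /=.
    rewrite [X in X @ _ --> _](_ : _ = series (fun n => complex.Re (u n))) //.
    by apply/funext => n; rewrite /series /= raddf_sum.
  rewrite [X in X @ _ --> _](_ : _ = series (fun n => complex.Im (u n))) //.
  by apply/funext => n; rewrite /series /= raddf_sum.
move=> ul; rewrite /hardy_ip -/u.
by rewrite (cvg_lim (@norm_hausdorff _ _) ul).
Qed.

Lemma hardy_ipE g h (l : cplx R) :
  series (fun n => (taylor g n)^* * taylor h n : cplx R) n @[n --> \oo] --> l ->
  hardy_ip g h = l.
Proof. exact: (cvg_lim (@norm_hausdorff _ _)). Qed.

Lemma hardy_ip_linear g : linear_for *%R (hardy_ip g).
Proof.
move=> c x y; apply: hardy_ipE.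
rewrite [X in X @ _ --> _](_ : _ = (fun n =>
  (c : cplx R) *: series (fun n => (taylor g n)^* * taylor x n : cplx R) n +
  series (fun n => (taylor g n)^* * taylor y n : cplx R) n)).
  by apply: cvgD; [apply: cvgZl_tmp|]; exact: hardy_ip_cvg.
apply/funext => n; rewrite /series /= scaler_sumr -big_split /=.
apply: eq_bigr => k _.
transitivity ((taylor g k)^* * (c * taylor x k + taylor y k)) => //.
by rewrite mulrDr; congr (_ + _); rewrite mulrCA.
Qed.

Lemma hardy_ip_conj g h : hardy_ip h g = (hardy_ip g h)^*.
Proof.
apply: hardy_ipE; apply/cvgrPdist_lt => e e0.
have /cvgrPdist_lt /(_ e e0) := @hardy_ip_cvg g h.
apply: filterS => n; rewrite -norm_conjC rmorphB /= => H.
rewrite (_ : series _ n = (series (fun n => (taylor g n)^* * taylor h n : cplx R) n)^*) //.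
rewrite /series /= rmorph_sum; apply: eq_bigr => k _.
by rewrite rmorphM /= conjCK mulrC.
Qed.

Lemma hardy_ip_norm h : hardy_ip h h = `|h| ^+ 2.
Proof.
rewrite hardy_normE -rmorphXn sqr_sqrtr ?sqnorm_ge0 //.
apply: hardy_ipE.
rewrite [X in X @ _ --> _](_ : _ = (fun n => (psum (taylor h) n)%:C%C)).
  apply: cvg_ReIm => /=; first exact: psum_cvg.
  exact: cvg_cst.
apply/funext => n; rewrite /psum /series /= rmorph_sum.
by apply: eq_bigr => k _; rewrite mulrC -normCK norm_sqmod.
Qed.

HB.instance Definition _ := @CompleteNormedModule_isHilbert.Build R hardy
  hardy_ip hardy_ip_linear hardy_ip_conj hardy_ip_norm.


Definition hardy_eval h (z : cplx R) : cplx R :=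
  limn (series (fun n => taylor h n * z ^+ n : cplx R)).

(* [k_w z = \sum_n (w^* z) ^ n]; the default value 0 is only taken for [w]
   outside the unit disk. *)
Definition szego (w : cplx R) : hardy :=
  insubd 0 (fun n => (w^*) ^+ n : cplx R).

(* [z |-> z ^ n]; these functions are an orthonormal basis of [hardy]. *)
Definition monomial (n : nat) : hardy :=
  insubd 0 (fun k => (k == n)%:R : cplx R).

Lemma taylor_monomial n k : taylor (monomial n) k = (k == n)%:R.
Proof.
rewrite /monomial (_ : taylor _ = (fun k => (k == n)%:R)) //.
rewrite [LHS]insubdK //; apply/square_summableP; exists 1 => m.
rewrite /psum /series /=.
under eq_bigr => i _.
  rewrite (_ : sqmod _ = if i == n then 1 else 0); last first.
    by rewrite sqmodE; case: eqP => _ /=; rewrite ?expr1n !expr0n /= addr0.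
  over.
rewrite -big_mkcond /= big_mkord.
rewrite (eq_bigl (fun i : 'I_m => (i : nat) == n)) //.
have [nm|mn] := ltnP n m.
  by rewrite (big_pred1 (Ordinal nm)).
rewrite big_pred0 ?ler01 // => i; apply/negbTE.
by rewrite neq_ltn (leq_trans (ltn_ord i) mn).
Qed.

Lemma sqmodX z n : sqmod (z ^+ n) = sqmod z ^+ n.
Proof.
elim: n => [|n IH]; last by rewrite !exprS sqmodM IH.
by rewrite !expr0 sqmodE /= expr1n expr0n addr0.
Qed.

Lemma sqmod_lt1 w : disk w -> sqmod w < 1.
Proof.
move=> w1; have : `|w| ^+ 2 < 1 by rewrite exprn_ilt1.
by rewrite norm_sqmod -[1]/(1%:C%C) ltcR.
Qed.

Lemma taylor_szego w n : disk w -> taylor (szego w) n = (w^*) ^+ n.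
Proof.
move=> w1; rewrite /szego (_ : taylor _ = (fun n => (w^*) ^+ n)) //.
rewrite [LHS]insubdK //; apply/asboolP.
rewrite (_ : (fun n => _) = geometric 1 (sqmod w)).
  by apply: is_cvg_geometric_series; rewrite ger0_norm ?sqmod_ge0 ?sqmod_lt1.
apply/funext => k; rewrite /= mul1r sqmodX; congr (_ ^+ _).
by rewrite !sqmodE; case: (w) => x y /=; rewrite sqrrN.
Qed.

Lemma szego_reproducing w h : disk w -> ip (szego w) h = hardy_eval h w.
Proof.
move=> w1; rewrite /hardy_eval (_ : (fun n => _) =
  (fun n => (taylor (szego w) n)^* * taylor h n)) //.
by apply/funext => n; rewrite taylor_szego // rmorphXn /= conjCK mulrC.
Qed.

Lemma hardy_eval_szego z w : disk z -> disk w ->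
  hardy_eval (szego w) z = (1 - z * w^*)^-1.
Proof.
move=> z1 w1; rewrite /hardy_eval; pose q : cplx R := z * w^*.
have q1 : `|q| < 1 by rewrite normrM norm_conjC mulr_ilt1.
have q10 : 1 - q != 0.
  by rewrite subr_eq0; apply: contraTneq q1 => <-; rewrite normr1 ltxx.
apply: (cvg_lim (@norm_hausdorff _ _)).
rewrite [X in X @ _ --> _](_ : _ = (fun n => (1 - q ^+ n) * (1 - q)^-1)).
  rewrite -[X in _ --> X]mul1r; apply: cvgMr_tmp.
  rewrite -[X in _ --> X]subr0; apply: cvgB; first exact: cvg_cst.
  apply/cvgrPdist_lt => e /gt0_complexE[]; set r := complex.Re e => r0 ->.
  have qs : `|sqmod q| < 1 by rewrite ger0_norm ?sqmod_ge0 ?sqmod_lt1.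
  have /cvgrPdist_lt /(_ (r ^+ 2)) := cvg_expr qs.
  move=> /(_ (exprn_gt0 _ r0)); apply: filterS => n.
  rewrite !sub0r !normrN -sqmodX ger0_norm ?sqmod_ge0 // => H.
  rewrite -(@ltr_pXn2r _ 2) ?nnegrE ?normr_ge0 ?lecR ?(ltW r0) //.
  by rewrite norm_sqmod -rmorphXn ltcR.
apply/funext => n; rewrite /series /= (_ : \sum_(0 <= k < n) _ =
    \sum_(k < n) q ^+ k); last first.
  by rewrite big_mkord; apply: eq_bigr => k _; rewrite taylor_szego // exprMn mulrC.
rewrite -[1 in X in X * _](expr1n _ n) subrXX.
by rewrite mulrAC mulfV // mul1r; apply: eq_bigr => k _; rewrite expr1n mul1r.
Qed.

(* By definition the trace is computed in the basis of monomials; for a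
   trace-class operator it does not depend on the orthonormal basis. *)
Definition trace (A : hardy -> hardy) : R[i]%C :=
  limn (series (fun n => ip (monomial n) (A (monomial n)) : cplx R)).

Definition trace_norm (A : hardy -> hardy) : \bar R :=
  (\sum_(0 <= n <oo)
     (complex.Re (ip (monomial n) (op_abs A (monomial n))))%:E)%E.

Definition trace_class (A : hardy -> hardy) : Prop :=
  bounded_op A /\ (trace_norm A < +oo)%E.

(* The ultraweak topology is induced by the functionals [S |-> Tr(rho S)]. *)
Definition ultraweakly (S : nat -> hardy -> hardy) (S0 : hardy -> hardy) :=
  forall rho, trace_class rho ->
    (trace (rho \o S n) : cplx R) @[n --> \oo] --> (trace (rho \o S0) : cplx R).

(* Only the values of [Psi] on trace-class operators are meaningful, and these
   are determined by [Phi]. *)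
Definition is_preadjoint (Phi Psi : (hardy -> hardy) -> hardy -> hardy) :=
  forall rho, trace_class rho -> trace_class (Psi rho) /\
    forall S, bounded_op S -> trace (Psi rho \o S) = trace (rho \o Phi S).

(* The kernel of the de Branges-Rovnyak space of [f]. *)
Definition dbr_kernel (f : cplx R -> cplx R) : cplx R -> cplx R -> cplx R :=
  fun z w => (1 - f z * (f w)^*) / (1 - z * w^*).

Definition is_dbr_isometry (f : cplx R -> cplx R)
    (Hf : rkhs disk (dbr_kernel f)) (T : hilbert_tensor hardy Hf)
    (V : hardy -> T) : Prop :=
  linear_isometry V /\
  forall w, disk w -> V (szego w) = tens T (szego (f w)) (rk_ker Hf w).

(* [S |-> V^* (S (x) I) V]. *)
Definition dbr_channel (K : hilbertType R) (T : hilbert_tensor hardy K)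
    (V : hardy -> T) (S : hardy -> hardy) : hardy -> hardy :=
  adjoint V \o ampl S \o V.

Definition unit_szego (a : cplx R) : hardy := `|szego a|^-1 *: szego a.

End Hardy.

Arguments hardy R : clear implicits.

(* Main.v *)
(* Iterating [V k_w = k_{f w} (x) c_{f,w}] gives, for kernels,
     <k_z, Phi^n(S) k_w> =
       <k_{f^n z}, S k_{f^n w}> (1 - f^n(z) f^n(w)^* ) / (1 - z w^* ),
   and both [f^n z] and [f^n w] tend to [a], so the right hand side tends to
   <k~_a, S k~_a> <k_z, k_w>, uniformly for [S] in a ball of operators.
   As [Phi] does not increase the norm and the kernels are total, the same holds
   with arbitrary vectors [x], [y] in place of the kernels.
   A trace-class operator is a sum [rho = \sum_j |x_j><y_j|] with
   [\sum_j |x_j|^2] and [\sum_j |y_j|^2] finite (polar decomposition and a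
   square root of [|rho|]), and Tr(rho Phi^n(S)) = \sum_j <y_j, Phi^n(S) x_j>;
   dominated convergence then gives
   Tr(rho Phi^n(S)) -> Tr(rho) <k~_a, S k~_a> uniformly over contractions [S].
   Taking [S] to be the adjoint of the polar isometry of
   Phi_*^n(rho) - Tr(rho) rho_a, cut off to finitely many coordinates,
   turns this into convergence in trace norm. *)

Require Import Defs.
From HB Require Import structures.
From mathcomp Require Import all_boot all_order all_algebra.
From mathcomp Require Import complex.
From mathcomp Require Import all_classical all_reals all_analysis.
From mathcomp Require Import ring lra.

Set Implicit Arguments.
Unset Strict Implicit.
Unset Printing Implicit Defensive.
Import Order.TTheory GRing.Theory Num.Theory.
Import numFieldNormedType.Exports.
Local Open Scope classical_set_scope.
Local Open Scope ring_scope.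

(** * Norms and series *)

(** The quotient in the formula for kernels is a telescoping product: each application of the
    channel contributes [dbr_kernel f] at the current pair of points, and its numerator is the
    denominator of the next factor. In the limit the numerator becomes 1 - |a|^2 = 1/|k_a|^2, which
    is where the normalized kernel comes from. Two obstacles shape the development. The trace norm
    asks for an estimate uniform over contractions [S], so limits are taken along a filter on pairs
    [(n, S)] that constrains only [n]; Tannery's theorem, stated for an arbitrary proper filter,
    then gives the uniform statement, and fixing one [S] gives the ultraweak one. Moreover
    [adjoint], [op_abs] and [ampl] are choices by [xget], which say nothing before existence is
    shown. Adjoints are built from Taylor coefficients, square roots by an iteration whose
    increments are polynomials with nonnegative coefficients, and both the polar isometry and S (x)
    I as closures of bounded, densely defined linear relations; for S (x) I the bound comes from the
    Schur product theorem, without a choice of basis. *)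

Section RealNorm.
Context {R : realType}.

(** The norm of a module over [R[i]] is an element of [R[i]]; passing to its real part, with nothing
    lost by [rnE], makes real square roots, real limits and [lra] available for norms. *)
Definition rn (V : normedZmodType R[i]%C) (x : V) : R := complex.Re `|x|.

Section NormedZmod.
Variable V : normedZmodType R[i]%C.
Implicit Types x y : V.

Lemma rnE x : `|x| = (rn x)%:C%C.
Proof.
rewrite /rn; have := normr_ge0 x; case: `|x| => u v.
by rewrite lecE /= => /andP[/eqP -> _].
Qed.

Lemma rn_ge0 x : 0 <= rn x.
Proof. by rewrite -lecR -rnE normr_ge0. Qed.

Lemma rnD x y : rn (x + y) <= rn x + rn y.
Proof. by rewrite -lecR rmorphD /= -!rnE ler_normD. Qed.

Lemma rn0 : rn (0 : V) = 0.
Proof. by rewrite /rn normr0. Qed.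

Lemma rnN x : rn (- x) = rn x.
Proof. by rewrite /rn normrN. Qed.

Lemma rnBC x y : rn (x - y) = rn (y - x).
Proof. by rewrite -opprB rnN. Qed.

Lemma rnB x y : rn (x - y) <= rn x + rn y.
Proof. by rewrite -(rnN y) rnD. Qed.

Lemma rn_eq0 x : rn x = 0 -> x = 0.
Proof. by move=> x0; apply/eqP; rewrite -normr_eq0 rnE x0. Qed.

Lemma rn_triangle (z x y : V) : rn (x - y) <= rn (x - z) + rn (z - y).
Proof. by apply: le_trans (rnD _ _); rewrite addrA subrK. Qed.

Lemma rn_sum (I : Type) (r : seq I) (P : pred I) (F : I -> V) :
  rn (\sum_(i <- r | P i) F i) <= \sum_(i <- r | P i) rn (F i).
Proof.
elim/big_ind2 : _ => [|x a y b xa yb|//]; first by rewrite rn0.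
exact: le_trans (rnD _ _) (lerD xa yb).
Qed.

End NormedZmod.

Lemma rnZ (V : normedModType R[i]%C) (c : R[i]%C) (x : V) :
  rn (c *: x) = rn c * rn x.
Proof. by apply: complexI; rewrite rmorphM /= -!rnE normrZ. Qed.

Lemma rnM (b c : R[i]%C) : rn (b * c) = rn b * rn c.
Proof. by apply: complexI; rewrite rmorphM /= -!rnE normrM. Qed.

Lemma rn_conj (c : R[i]%C) : rn (c^*) = rn c.
Proof. by rewrite /rn norm_conjC. Qed.

Lemma rn1 : rn (1 : R[i]%C) = 1.
Proof. by rewrite /rn normr1. Qed.

Lemma rn_real (x : R) : rn (x%:C%C : R[i]%C) = `|x|.
Proof.
by rewrite /rn normc_def /= expr0n addr0 sqrtr_sqr.
Qed.

Lemma Re_le_rn (c : R[i]%C) : complex.Re c <= rn c.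
Proof.
rewrite /rn normc_def /=; apply: le_trans (ler_norm _) _.
by rewrite -sqrtr_sqr ler_wsqrtr // lerDl sqr_ge0.
Qed.

Lemma mulcJ (c : R[i]%C) : c * c^* = (rn c ^+ 2)%:C%C.
Proof. by rewrite -normCK rnE rmorphXn. Qed.

Lemma cvg_rnP (V : normedModType R[i]%C) (T : Type) (F : set_system T)
    {FF : Filter F} (u : T -> V) (l : V) :
  u x @[x --> F] --> l <-> rn (u x - l) @[x --> F] --> (0 : R).
Proof.
split => [/cvgrPdist_lt ul|/cvgrPdist_lt ul]; apply/cvgrPdist_lt => e e0.
  have : \forall x \near F, `|l - u x| < e%:C%C by apply: ul; rewrite ltcR.
  apply: filterS => x; rewrite rnE ltcR => H.
  by rewrite sub0r normrN ger0_norm ?rn_ge0 // rnBC.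
have [e1 ->] := gt0_complexE e0.
apply: filterS (ul _ e1) => x.
by rewrite sub0r normrN ger0_norm ?rn_ge0 // rnBC rnE ltcR.
Qed.

Lemma cvg_rn0_le (T : Type) (F : set_system T) {FF : Filter F}
    (V : normedModType R[i]%C) (u : T -> V) (l : V) (b : T -> R) :
  (\forall x \near F, rn (u x - l) <= b x) -> b x @[x --> F] --> (0 : R) ->
  u x @[x --> F] --> l.
Proof.
move=> ub b0; apply/cvg_rnP; apply: squeeze_cvgr b0; last exact: cvg_cst.
by apply: filterS ub => x ->; rewrite rn_ge0.
Qed.

Lemma cvg_rn (T : Type) (F : set_system T) {FF : Filter F}
    (V : normedModType R[i]%C) (u : T -> V) (l : V) :
  u x @[x --> F] --> l -> rn (u x) @[x --> F] --> rn l.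
Proof.
move=> /cvg_rnP ul; apply/cvgrPdist_le => e e0.
move/cvgrPdist_le : ul => /(_ e e0); apply: filterS => x.
rewrite sub0r normrN ger0_norm ?rn_ge0 //; apply: le_trans.
have := rnD (u x - l) l; have := rnD (l - u x) (u x).
by rewrite !subrK (rnBC l) ler_norml => *; apply/andP; split; lra.
Qed.

Lemma cvg_rn_le (T : Type) (F : set_system T) {FF : ProperFilter F}
    (V : normedModType R[i]%C) (u : T -> V) (l : V) (C : R) :
  u x @[x --> F] --> l -> (\forall x \near F, rn (u x) <= C) -> rn l <= C.
Proof.
move=> /cvg_rn ul uC.
exact: cvgr_to_le ul uC.
Qed.

Lemma cvg_eqc (T : Type) (F : set_system T) {FF : ProperFilter F}
    (V : normedModType R[i]%C) (u : T -> V) (l l' : V) :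
  u x @[x --> F] --> l -> u x @[x --> F] --> l' -> l = l'.
Proof. exact: cvg_unique. Qed.

Lemma rn_cauchy (V : completeNormedModType R[i]%C) (u : nat -> V)
    (b : nat -> R) :
  (forall m n, (m <= n)%N -> rn (u m - u n) <= b m) ->
  b n @[n --> \oo] --> (0 : R) -> cvgn u.
Proof.
move=> ub b0; apply/cauchy_cvgP; apply/cauchy_exP => e e0.
have [e1 ->] := gt0_complexE e0.
move/cvgrPdist_lt : b0 => /(_ _ e1) [N _ bN].
exists (u N); exists N => // n /= Nn; rewrite -ball_normE /ball_ /= rnE ltcR.
apply: le_lt_trans (ub _ _ Nn) _; apply: le_lt_trans (ler_norm _) _.
by rewrite -normrN -sub0r; apply: bN => /=.
Qed.

Lemma series_tail_cvg0 (t : nat -> R) : cvgn (series t) ->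
  limn (series t) - series t n @[n --> \oo] --> (0 : R).
Proof.
move=> ct; rewrite -[X in _ --> X](subrr (limn (series t))).
by apply: cvgB => //; exact: cvg_cst.
Qed.

Lemma series_tail_le (t : nat -> R) m n : (forall j, 0 <= t j) ->
  cvgn (series t) -> (m <= n)%N ->
  \sum_(m <= j < n) t j <= limn (series t) - series t m.
Proof.
move=> t0 ct mn; rewrite lerBrDl.
have -> : series t m + \sum_(m <= j < n) t j = series t n.
  by rewrite /series /= -big_cat_nat.
by apply: (nondecreasing_cvgn_le _ ct n); apply: nondecreasing_series.
Qed.

Lemma rn_series_tail (V : normedModType R[i]%C) (u : nat -> V) (t : nat -> R)
    m n : (forall j, rn (u j) <= t j) -> cvgn (series t) -> (m <= n)%N ->
  rn (series u m - series u n) <= limn (series t) - series t m.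
Proof.
move=> ut ct mn.
have -> : series u m - series u n = - \sum_(m <= j < n) u j.
  have -> : series u n = series u m + \sum_(m <= j < n) u j.
    by rewrite /series /= -big_cat_nat.
  by rewrite opprD addrA subrr add0r.
rewrite rnN; apply: le_trans (rn_sum _ _ _) _.
apply: le_trans (series_tail_le _ ct mn); first exact: ler_sum.
by move=> j; apply: le_trans (ut j); exact: rn_ge0.
Qed.

Lemma rn_series_dist (V : normedModType R[i]%C) (u : nat -> V) (l : V)
    (t : nat -> R) m : (forall j, rn (u j) <= t j) -> cvgn (series t) ->
  series u n @[n --> \oo] --> l ->
  rn (series u m - l) <= limn (series t) - series t m.
Proof.
move=> ut ct ul; have c : series u m - series u n @[n --> \oo] --> series u m -
  l.
  by apply: cvgB => //; exact: cvg_cst.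
apply: cvg_rn_le c _; exists m => // n /= mn; exact: rn_series_tail.
Qed.

Lemma cplx_series_cvg (u : nat -> cplx R) (t : nat -> R) :
  (forall j, rn (u j) <= t j) -> cvgn (series t) -> cvgn (series u).
Proof.
move=> ut ct.
have ReIm (c : R[i]%C) : `|complex.Re c| <= rn c /\ `|complex.Im c| <= rn c.
  rewrite /rn normc_def /= -!sqrtr_sqr.
  by split; rewrite ler_wsqrtr // ?lerDl ?lerDr sqr_ge0.
have /cvg_ex[a ra] : cvgn (series (fun n => complex.Re (u n))).
  by apply: abs_cvg ct => n; apply: le_trans (ut n); exact: (ReIm _).1.
have /cvg_ex[b ib] : cvgn (series (fun n => complex.Im (u n))).
  by apply: abs_cvg ct => n; apply: le_trans (ut n); exact: (ReIm _).2.
apply/cvg_ex; exists (Complex a b : cplx R); apply: cvg_ReIm => /=.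
  rewrite (_ : (fun n => _) = series (fun n => complex.Re (u n))) //.
  by apply/funext => n; rewrite /series /= raddf_sum.
rewrite (_ : (fun n => _) = series (fun n => complex.Im (u n))) //.
by apply/funext => n; rewrite /series /= raddf_sum.
Qed.

Lemma cvg_fsum (V : normedModType R[i]%C) (T J : Type)
    (F : set_system T) {FF : Filter F} (r : seq J) (g : T -> J -> V)
    (l : J -> V) : (forall j, g p j @[p --> F] --> l j) ->
  \sum_(j <- r) g p j @[p --> F] --> \sum_(j <- r) l j.
Proof.
move=> gl; elim: r => [|j r IH].
  rewrite big_nil; under eq_fun do rewrite big_nil; exact: cvg_cst.
rewrite big_cons; under eq_fun do rewrite big_cons; exact: cvgD.
Qed.

(* Tannery's theorem. *)
Lemma series_dominated_cvg (T : Type)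
    (F : set_system T) {FF : ProperFilter F} (g : T -> nat -> cplx R)
    (G : T -> cplx R) (l : nat -> cplx R) (t : nat -> R) :
  (\forall p \near F, forall j, rn (g p j) <= t j) ->
  (\forall p \near F, series (g p) n @[n --> \oo] --> G p) ->
  cvgn (series t) -> (forall j, g p j @[p --> F] --> l j) ->
  cvgn (series l) /\ G p @[p --> F] --> limn (series l).
Proof.
move=> gt gG ct gl.
have lt j : rn (l j) <= t j.
  by apply: cvg_rn_le (gl j) _; apply: filterS gt => p; exact.
have cl : cvgn (series l) by apply: cplx_series_cvg ct.
split => //; apply/cvg_rnP; apply/cvgrPdist_le => e e0.
(* One third for each of the two tails beyond [N], one for the sums of the first [N] terms. The same
   [N] serves every [p], since the majorant [t] does not depend on [p]. *)
have e30 : 0 < e / 3 by rewrite divr_gt0.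
have /cvgrPdist_le/(_ _ e30)[N _ tN] := series_tail_cvg0 ct.
have tail (u : nat -> cplx R) (L : cplx R) : (forall j, rn (u j) <= t j) ->
    series u n @[n --> \oo] --> L -> rn (series u N - L) <= e / 3.
  move=> ut uL; apply: le_trans (rn_series_dist N ut ct uL) _.
  by apply: le_trans (tN N (leqnn _)); rewrite sub0r normrN ler_norm.
have head : series (g p) N @[p --> F] --> series l N.
  by apply: cvg_fsum => j; exact: gl.
have /cvg_rnP/cvgrPdist_le/(_ _ e30) hd := head.
 apply: filterS3 gt gG hd => p gpt gpG hp.
rewrite sub0r normrN ger0_norm ?rn_ge0 //.
move: hp; rewrite sub0r normrN ger0_norm ?rn_ge0 // => hp.
have h1 := tail _ _ gpt gpG; have h2 := tail _ _ lt cl.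
apply: le_trans (rn_triangle (series (g p) N) _ _) _; rewrite rnBC.
have := rn_triangle (series l N) (series (g p) N) (limn (series l)).
by lra.
Qed.

End RealNorm.

Section LinearFunctions.
Context {R : realType}.
Variables (H K : lmodType R[i]%C) (A : H -> K).
Hypothesis linA : linear A.

Lemma linD x y : A (x + y) = A x + A y.
Proof. by have := linA 1 x y; rewrite !scale1r. Qed.

Lemma lin0 : A 0 = 0.
Proof. by apply: (addIr (A 0)); rewrite -linD !add0r. Qed.

Lemma linZ c x : A (c *: x) = c *: A x.
Proof. by have := linA c x 0; rewrite lin0 !addr0. Qed.

Lemma linN x : A (- x) = - A x.
Proof. by rewrite -scaleN1r linZ scaleN1r. Qed.

Lemma linB x y : A (x - y) = A x - A y.
Proof. by rewrite linD linN. Qed.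

Lemma lin_sum (I : Type) (r : seq I) (P : pred I) (F : I -> H) :
  A (\sum_(i <- r | P i) F i) = \sum_(i <- r | P i) A (F i).
Proof. by apply: (big_morph A linD lin0). Qed.

End LinearFunctions.

(** * Hilbert spaces *)

Section InnerProduct.
Context {R : realType}.
Variable H : hilbertType R.
Implicit Types x y z : H.

Lemma ipDr x y z : ip x (y + z) = ip x y + ip x z.
Proof. by have := ip_linear x 1 y z; rewrite scale1r mul1r. Qed.

Lemma ip0r x : ip x 0 = 0.
Proof. by apply: (addIr (ip x 0)); rewrite -ipDr !add0r. Qed.

Lemma ipZr c x y : ip x (c *: y) = c * ip x y.
Proof. by have := ip_linear x c y 0; rewrite ip0r !addr0. Qed.

Lemma ipNr x y : ip x (- y) = - ip x y.
Proof. by rewrite -scaleN1r ipZr mulN1r. Qed.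

Lemma ipBr x y z : ip x (y - z) = ip x y - ip x z.
Proof. by rewrite ipDr ipNr. Qed.

Lemma ip_sumr (I : Type) (r : seq I) (P : pred I) (F : I -> H) x :
  ip x (\sum_(i <- r | P i) F i) = \sum_(i <- r | P i) ip x (F i).
Proof. exact: (big_morph (ip x) (ipDr x) (ip0r x)). Qed.

Lemma ipDl x y z : ip (y + z) x = ip y x + ip z x.
Proof. by rewrite ip_conj ipDr rmorphD /= -!ip_conj. Qed.

Lemma ip0l x : ip 0 x = 0.
Proof. by rewrite ip_conj ip0r rmorph0. Qed.

Lemma ipZl c x y : ip (c *: y) x = c^* * ip y x.
Proof. by rewrite ip_conj ipZr rmorphM /= -ip_conj. Qed.

Lemma ipNl x y : ip (- y) x = - ip y x.
Proof. by rewrite ip_conj ipNr rmorphN /= -ip_conj. Qed.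

Lemma ipBl x y z : ip (y - z) x = ip y x - ip z x.
Proof. by rewrite ipDl ipNl. Qed.

Lemma ip_suml (I : Type) (r : seq I) (P : pred I) (F : I -> H) x :
  ip (\sum_(i <- r | P i) F i) x = \sum_(i <- r | P i) ip (F i) x.
Proof. exact: (big_morph (ip^~ x) (ipDl x) (ip0l x)). Qed.

Lemma ip_rn x : ip x x = (rn x ^+ 2)%:C%C.
Proof. by rewrite ip_norm rnE rmorphXn. Qed.

Lemma rn_sqr x : rn x ^+ 2 = complex.Re (ip x x).
Proof. by rewrite ip_rn. Qed.

Lemma Re_ipC x y : complex.Re (ip y x) = complex.Re (ip x y).
Proof. by rewrite ip_conj; case: (ip x y). Qed.

Lemma rnD_sqr x y :
  rn (x + y) ^+ 2 = rn x ^+ 2 + 2 * complex.Re (ip x y) + rn y ^+ 2.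
Proof.
rewrite !rn_sqr !(ipDl, ipDr) !raddfD /= (Re_ipC x y); ring.
Qed.

Lemma rnB_sqr x y :
  rn (x - y) ^+ 2 = rn x ^+ 2 - 2 * complex.Re (ip x y) + rn y ^+ 2.
Proof. by rewrite rnD_sqr ipNr rnN raddfN /=; ring. Qed.

Lemma rnB_sqr_ip x y : rn (x - y) ^+ 2 =
  complex.Re (ip x x) - 2 * complex.Re (ip x y) + complex.Re (ip y y).
Proof. by rewrite rnB_sqr !rn_sqr. Qed.

Lemma parallelogram x y :
  rn (x + y) ^+ 2 + rn (x - y) ^+ 2 = 2 * rn x ^+ 2 + 2 * rn y ^+ 2.
Proof. by rewrite rnD_sqr rnB_sqr; ring. Qed.

Lemma rn_sub_proj x y (t : R) :
  rn (x - (t%:C%C * ip y x) *: y) ^+ 2 =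
  rn x ^+ 2 - 2 * t * rn (ip y x) ^+ 2 + t ^+ 2 * rn (ip y x) ^+ 2 * rn y ^+ 2.
Proof.
rewrite rnB_sqr ipZr rnZ rnM rn_real (ip_conj y x) -(mulrA t%:C%C) mulcJ
  -rmorphM /=.
by rewrite !exprMn real_normK ?num_real //; ring.
Qed.

Lemma ip_le_rn x y : rn (ip x y : R[i]%C) <= rn x * rn y.
Proof.
have [x0|x0] := eqVneq (rn x) 0.
  by rewrite (rn_eq0 x0) ip0l !rn0 mul0r.
have xp : 0 < rn x by rewrite lt_neqAle eq_sym x0 rn_ge0.
rewrite -(@ler_pXn2r _ 2) ?nnegrE ?mulr_ge0 ?rn_ge0 // exprMn.
have := rn_sub_proj y x (rn x ^- 2).
set s := rn (ip x y) ^+ 2 => E.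
have : 0 <= rn y ^+ 2 - rn x ^- 2 * s.
  rewrite (_ : _ - _ = rn (y - ((rn x ^- 2)%:C%C * ip x y) *: x) ^+ 2).
    exact: sqr_ge0.
  by rewrite E; field.
rewrite subr_ge0 => /(ler_wpM2l (sqr_ge0 (rn x))).
by rewrite mulrA divff ?mul1r // expf_neq0.
Qed.

Lemma ip_ext x y : (forall z, ip z x = ip z y) -> x = y.
Proof.
move=> xy; apply/eqP; rewrite -subr_eq0; apply/eqP/rn_eq0/eqP.
by rewrite -sqrf_eq0 rn_sqr ipBr xy subrr.
Qed.

Lemma ip_extl x y : (forall z, ip x z = ip y z) -> x = y.
Proof.
by move=> xy; apply: ip_ext => z; rewrite ip_conj xy -ip_conj.
Qed.

Lemma cvg_ip (T : Type) (F : set_system T) {FF : Filter F} (u v : T -> H) x y :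
  u t @[t --> F] --> x -> v t @[t --> F] --> y ->
  (ip (u t) (v t) : cplx R) @[t --> F] --> (ip x y : cplx R).
Proof.
move=> ux vy; apply: (@cvg_rn0_le _ _ _ _ _ _ _
  (fun t => rn (u t - x) * rn (v t) + rn x * rn (v t - y))).
  apply: nearW => t.
  rewrite (_ : ip (u t) (v t) - ip x y = ip (u t - x) (v t) + ip x (v t - y)).
    by apply: le_trans (rnD _ _) (lerD _ _); exact: ip_le_rn.
  by rewrite ipBl ipBr addrA subrK.
rewrite (_ : 0 = 0 * rn y + rn x * 0); last by rewrite mul0r mulr0 addr0.
apply: cvgD; apply: cvgM.
- by apply/cvg_rnP.
- exact: cvg_rn.
- exact: cvg_cst.
- by apply/cvg_rnP.
Qed.

(** With s = |<m, q>| and t = 1/(|m|^2 + 1), the choice c = t <m, q> changes |q|^2 by s^2 t (t |m|^2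
    - 2), which is negative unless s = 0. The summand 1 in the denominator covers m = 0. *)
Lemma orth_of_nearest (q m : H) :
  (forall c, rn q ^+ 2 <= rn (q - c *: m) ^+ 2) -> ip m q = 0.
Proof.
move=> qm; have := qm ((rn m ^+ 2 + 1)^-1%:C%C * ip m q).
rewrite rn_sub_proj; set s := rn (ip m q); set n := rn m ^+ 2.
have n0 : 0 <= n by exact: sqr_ge0.
have n1 : 0 < n + 1 by lra.
move=> sn; apply/rn_eq0/eqP; rewrite -/s -sqrf_eq0 eq_le sqr_ge0 andbT.
have : 0 <= s ^+ 2 * (n + 1)^-1 * ((n + 1)^-1 * n - 2) by lra.
rewrite -mulrA mulrCA pmulr_rge0 ?invr_gt0 // => s0.
have : (n + 1)^-1 * n <= 1 by rewrite ler_pdivrMl //; lra.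
by have := sqr_ge0 s; nra.
Qed.

End InnerProduct.

(** * Orthogonal decomposition, bounded extension and partial isometries *)

Section Projection.
Context {R : realType}.
Variables (H : hilbertType R) (M : set H).
Hypothesis M0 : M 0.
Hypothesis Mlin : forall c u v, M u -> M v -> M (c *: u + v).

(** [M] need not be closed, so the component along [M] is only approximated by elements of [M]. The
    vector [q] is [h] minus the limit of a minimizing sequence. *)
Lemma orthogonal_decomposition h :
  exists2 q, (forall m, M m -> ip m q = 0) &
    forall e : R, 0 < e -> exists2 m, M m & rn (h - q - m) < e.
Proof.
pose E := [set rn (h - m) ^+ 2 | m in M].
have infE : has_inf E.
  split; first by exists (rn (h - 0) ^+ 2), 0.
  by exists 0 => _ [m _ <-]; exact: sqr_ge0.
have dE m : M m -> inf E <= rn (h - m) ^+ 2.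
  by move=> Mm; apply: ge_inf; [exact: infE.2|exists m].
have /choice[u uP] n : exists m, M m /\
    rn (h - m) ^+ 2 < inf E + n.+1%:R^-1.
  have [|_ [m Mm <-] mE] := @inf_adherent _ E n.+1%:R^-1 _ infE.
    by rewrite invr_gt0.
  by exists m.
have uM n : M (u n) by case: (uP n).
have ud n : rn (h - u n) ^+ 2 < inf E + n.+1%:R^-1 by case: (uP n).
have hc : (n.+1%:R^-1 : R) @[n --> \oo] --> (0 : R) by exact: cvg_harmonic.
have cu : cvgn u.
  (* The midpoint of [u i] and [u j] lies in [M], at squared distance at least [inf E] from [h]; the
     parallelogram law then bounds the squared distance of [u i] and [u j] by 2/(i+1) + 2/(j+1), at
     most 4/(i+1). *)
  apply: (@rn_cauchy _ _ _ (fun n => 2 * Num.sqrt n.+1%:R^-1)).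
    move=> i j ij; rewrite -(@ler_pXn2r _ 2) ?nnegrE ?mulr_ge0 ?rn_ge0
      ?sqrtr_ge0 //.
    rewrite exprMn sqr_sqrtr ?invr_ge0 //.
    have := parallelogram (h - u i) (h - u j).
    have -> : h - u i - (h - u j) = u j - u i by rewrite opprB addrC subrKA.
    have -> : h - u i + (h - u j) = 2 *: (h - (2^-1 *: u i + 2^-1 *: u j)).
      rewrite scalerBr scalerDr !scalerA divff ?pnatr_eq0 // !scale1r.
      by rewrite scaler_nat mulr2n opprD addrACA.
    rewrite rnZ exprMn (rnBC (u j)).
    have -> : rn (2 : R[i]%C) = 2.
      rewrite (_ : 2 = 2%:C%C) ?rn_real ?ger0_norm //.
      by rewrite rmorph_nat.
    have /dE : M (2^-1 *: u i + 2^-1 *: u j).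
      by apply: Mlin => //; rewrite -[_ *: _]addr0; exact: Mlin.
    have := ud i; have := ud j.
    have : (j.+1%:R^-1 : R) <= i.+1%:R^-1.
      by rewrite lef_pV2 ?posrE // ler_nat.
    by move: (i.+1%:R^-1) (j.+1%:R^-1) => s t; lra.
  rewrite -[X in _ --> X](mulr0 2); apply: cvgM; first exact: cvg_cst.
  rewrite -[X in _ --> X](@sqrtr0 R).
  by apply: continuous_cvg hc; exact: sqrt_continuous.
have up : u n @[n --> \oo] --> limn u by [].
set p := limn u in up.
have cup m : rn (h - u n - m) ^+ 2 @[n --> \oo] --> rn (h - p - m) ^+ 2.
  apply: cvgM; apply: cvg_rn; apply: cvgB; try exact: cvg_cst;
  by apply: cvgB => //; exact: cvg_cst.
exists (h - p) => [m Mm|e e0].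
  apply: orth_of_nearest => c.
  apply: (@le_trans _ _ (inf E)).
    have := cup 0; rewrite !subr0 => {}cup.
    rewrite -[leRHS]addr0; apply: ler_cvg_to cup (cvgD (cvg_cst _) hc) _.
    by apply: nearW => n; rewrite subr0; apply/ltW.
  apply: cvgr_to_ge (cup (c *: m)) _; apply: nearW => n.
  by rewrite -addrA -opprD; apply: dE; rewrite addrC; apply: Mlin.
have [N _ uN] : \forall n \near \oo, rn (u n - p) < e.
  move/cvg_rnP/cvgrPdist_lt : up => /(_ e e0); apply: filterS => n.
  by rewrite sub0r normrN; apply: le_lt_trans (ler_norm _).
exists (u N) => //; rewrite opprB (addrC p) addrA subrr add0r rnBC.
by apply: uN => /=.
Qed.

End Projection.

Section BoundedOperators.
Context {R : realType}.

Definition op_bound (H K : hilbertType R) (C : R) (A : H -> K) :=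
  forall x, rn (A x) <= C * rn x.

Section Continuity.
Variables (H K : hilbertType R) (A : H -> K).
Hypothesis linA : linear A.

Lemma op_bound_continuous C : op_bound C A -> continuous A.
Proof.
move=> hA x; apply: (@cvg_rn0_le _ _ _ _ _ _ _ (fun y => C * rn (y - x))).
  by apply: nearW => y; rewrite -linB.
rewrite -[X in _ --> X](mulr0 C); apply: cvgM; first exact: cvg_cst.
by apply/cvg_rnP; exact: cvg_id.
Qed.

Lemma continuous_op_bound : continuous A -> exists2 C, 0 < C & op_bound C A.
Proof.
move=> cA; have /cvg_rnP/cvgrPdist_lt/(_ 1 ltr01) := cA 0.
move=> /nbhs_norm0P[e0 /= /gt0_complexE[e e0E]] {}cA.
set d := complex.Re e0 in e e0E.
have {}cA y : rn y < d -> rn (A y) <= 1.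
  move=> yd; have := cA y; rewrite /= rnE e0E ltcR => /(_ yd).
  by rewrite lin0 // subr0 sub0r normrN ger0_norm ?rn_ge0 // => /ltW.
exists (2 / d) => [|x]; first by rewrite divr_gt0.
have [x0|x0] := eqVneq (rn x) 0.
  by rewrite (rn_eq0 x0) lin0 // !rn0 mulr0.
have xp : 0 < rn x by rewrite lt_neqAle eq_sym x0 rn_ge0.
have := cA ((d / 2 / rn x)%:C%C *: x).
rewrite linZ // !rnZ rn_real ger0_norm ?divr_ge0 ?rn_ge0 ?(ltW e) //.
rewrite divfK // => xd; have {xd} : d / 2 * rn (A x) / rn x <= 1.
  by rewrite mulrAC; apply: xd; lra.
by rewrite ler_pdivrMr // mul1r -ler_pdivlMl ?divr_gt0 // invf_div.
Qed.

End Continuity.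

Lemma bounded_opP (H K : hilbertType R) (A : H -> K) :
  bounded_op A <-> linear A /\ exists2 C, 0 < C & op_bound C A.
Proof.
split=> [[linA cA]|[linA [C _ hA]]]; split => //.
  exact: continuous_op_bound.
exact: op_bound_continuous hA.
Qed.

Lemma op_bound_comp (H K L : hilbertType R) C D (A : K -> L) (B : H -> K) :
  0 <= C -> op_bound C A -> op_bound D B -> op_bound (C * D) (A \o B).
Proof.
move=> C0 hA hB x /=; apply: le_trans (hA _) _; rewrite -mulrA.
exact: ler_wpM2l.
Qed.

Lemma linear_comp (H K L : lmodType R[i]%C) (A : K -> L) (B : H -> K) :
  linear A -> linear B -> linear (A \o B).
Proof. by move=> lA lB c x y; rewrite /= lB lA. Qed.

(** Linearity and the bound force the closure of [G] to be single-valued, and density with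
    completeness of [K] makes it total. Starting from a relation spares any check that values are
    independent of a representation, for instance as a sum of tensors. *)
Lemma linear_relation_extension (H K : hilbertType R) (G : H -> K -> Prop)
    (C : R) : 0 <= C ->
  G 0 0 ->
  (forall c u v u' v', G u v -> G u' v' -> G (c *: u + u') (c *: v + v')) ->
  (forall u v, G u v -> rn v <= C * rn u) ->
  (forall h (e : R), 0 < e -> exists u v, G u v /\ rn (h - u) < e) ->
  exists W : H -> K, [/\ linear W, op_bound C W & forall u v, G u v -> W u = v].
Proof.
move=> C0 G0 Glin GC Gdense.
(* The closure of the graph [G] in the product; [W] will select its unique second coordinate. *)
pose cl h w := forall e : R, 0 < e ->
  exists u v, [/\ G u v, rn (h - u) < e & rn (w - v) < e].
have Gcl u v : G u v -> cl u v.
  by move=> Guv e e0; exists u, v; rewrite !subrr !rn0.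
have clC h w : cl h w -> rn w <= C * rn h.
  move=> hw; apply/ler_addgt0Pr => e e0.
  have C1 : 0 < 1 + C by lra.
  have [|u [v [/GC uv hu wv]]] := hw (e / (1 + C)); first exact: divr_gt0.
  have -> : e = e / (1 + C) + C * (e / (1 + C)).
    by rewrite -[X in X + _]mul1r -mulrDl mulrC divfK ?gt_eqF.
  move: (e / (1 + C)) hu wv => d hu wv.
  have hu' : C * rn u <= C * (rn h + d).
    rewrite ler_wpM2l //; have := rnD h (u - h).
    by rewrite addrC subrK rnBC; lra.
  rewrite mulrDr in hu'; have := rnD v (w - v).
  by rewrite addrC subrK; lra.
have cllin c h w h' w' : cl h w -> cl h' w' -> cl (c *: h + h') (c *: w + w').
  move=> hw hw' e e0; have c0 := rn_ge0 (c : cplx R).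
  have c1 : 0 < rn c + 1 by have := rn_ge0 c; lra.
  have d0 : 0 < e / (rn c + 1) by rewrite divr_gt0.
  have [u [v [Guv hu wv]]] := hw _ d0.
  have [u' [v' [Guv' hu' wv']]] := hw' _ d0.
  have bnd (L : hilbertType R) (x y x' y' : L) : rn (x - y) < e / (rn c + 1) ->
      rn (x' - y') < e / (rn c + 1) ->
      rn (c *: x + x' - (c *: y + y')) < e.
    move=> xy xy'; rewrite opprD addrACA -scalerBr.
    apply: le_lt_trans (rnD _ _) _; rewrite rnZ.
    have -> : e = rn c * (e / (rn c + 1)) + e / (rn c + 1).
      by field; lra.
    by apply: ler_ltD => //; rewrite ler_wpM2l ?rn_ge0 // ltW.
  exists (c *: u + u'), (c *: v + v'); split; first exact: Glin.
    exact: bnd.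
  exact: bnd.
have cluniq h w w' : cl h w -> cl h w' -> w = w'.
  move=> hw hw'; have := cllin (-1) _ _ _ _ hw hw'.
  rewrite !scaleN1r addNr => /clC; rewrite rn0 mulr0 => ww'.
  have /rn_eq0/eqP : rn (- w + w') = 0.
    by apply/eqP; rewrite eq_le ww' rn_ge0.
  by rewrite addrC subr_eq0 => /eqP.
have clex h : exists w, cl h w.
  have /choice[u uP] n : exists p : H * K,
      G p.1 p.2 /\ rn (h - p.1) < n.+1%:R^-1.
    have [|u [v uv]] := Gdense h n.+1%:R^-1; first by rewrite invr_gt0.
    by exists (u, v).
  have hc : (n.+1%:R^-1 : R) @[n --> \oo] --> (0 : R) by exact: cvg_harmonic.
  have cu : cvgn (fun n => (u n).2).
    apply: (@rn_cauchy _ _ _ (fun n => C * (2 * n.+1%:R^-1))).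
      move=> i j ij; have [Gi hi] := uP i; have [Gj hj] := uP j.
      have := Glin (-1) _ _ _ _ Gj Gi; rewrite !scaleN1r => /GC.
      rewrite addrC => /le_trans; apply; rewrite ler_wpM2l // addrC.
      have := rn_triangle h (u i).1 (u j).1; rewrite (rnBC _ h).
      have : (j.+1%:R^-1 : R) <= i.+1%:R^-1.
        by rewrite lef_pV2 ?posrE // ler_nat.
      by move: (i.+1%:R^-1) (j.+1%:R^-1) hi hj => s t hi hj; lra.
    rewrite -[X in _ --> X](mulr0 C); apply: cvgM; first exact: cvg_cst.
    by rewrite -[X in _ --> X](mulr0 2); apply: cvgM => //; exact: cvg_cst.
  have /cvg_rnP ul : (u n).2 @[n --> \oo] --> limn (fun n => (u n).2) by [].
  exists (limn (fun n => (u n).2)) => e e0.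
  have [N _ uN] : \forall n \near \oo,
      rn ((u n).2 - limn (fun n => (u n).2)) < e /\ n.+1%:R^-1 < e.
    move/cvgrPdist_lt : ul => /(_ e e0) ul.
    move/cvgrPdist_lt : hc => /(_ e e0); apply: filterS2 ul => n.
    rewrite !sub0r !normrN => h1 h2.
    by split; apply: le_lt_trans (ler_norm _) _.
  have [uN1 uN2] := uN N (leqnn N); have [GN hN] := uP N.
  by exists (u N).1, (u N).2; split => //; [exact: lt_trans uN2|rewrite rnBC].
have [W WP] := choice clex; exists W; split.
- by move=> c x y; apply: cluniq (WP _) _; exact: cllin.
- by move=> x; exact: clC.
- by move=> u v /Gcl; apply: cluniq.
Qed.

End BoundedOperators.

Section Factorization.
Context {R : realType}.

(* [U] is the partial isometry of a polar decomposition. *)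
Lemma contraction_factorization (H : hilbertType R) (X Y : H -> H) :
  linear X -> linear Y -> (forall h, rn (Y h) = rn (X h)) ->
  exists U : H -> H, [/\ linear U, op_bound 1 U & forall h, U (X h) = Y h].
Proof.
move=> linX linY YX.
pose M : set H := range X.
have Mlin c u v : M u -> M v -> M (c *: u + v).
  by move=> [h _ <-] [h' _ <-]; exists (c *: h + h') => //; rewrite linX.
have M0 : M 0 by exists 0 => //; rewrite lin0.
(* The relation sends [X h] to [Y h] and kills what is orthogonal to the range of [X]. Pythagoras
   gives the bound 1, and [orthogonal_decomposition] makes the domain dense even when the range is
   not closed. *)
pose G u v := exists h q, [/\ forall m, M m -> ip m q = 0, u = X h + q & v = Y
  h].
have [||||U [linU U1 UG]] := @linear_relation_extension _ H H G 1 ler01.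
- by exists 0, 0; split=> [m _||]; rewrite ?ip0r ?(lin0 linX) ?(lin0 linY)
  ?addr0.
- move=> c _ _ _ _ [h [q [hq -> ->]]] [h' [q' [hq' -> ->]]].
  exists (c *: h + h'), (c *: q + q'); split; rewrite ?linX ?linY //.
    by move=> m Mm; rewrite ipDr ipZr hq // hq' // mulr0 addr0.
  by rewrite scalerDr addrACA.
- move=> _ _ [h [q [hq -> ->]]]; rewrite mul1r YX.
  rewrite -(@ler_pXn2r _ 2) ?nnegrE ?rn_ge0 // rnD_sqr hq //=; last by exists h.
  by have := sqr_ge0 (rn q); lra.
- move=> h e e0; have [q Mq qh] := orthogonal_decomposition M0 Mlin h.
  have [_ [x _ <-] xh] := qh _ e0.
  exists (X x + q), (Y x); split; first by exists x, q.
  by rewrite (addrC (X x)) opprD addrA.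
exists U; split => // h; apply: UG; exists h, 0.
by split; rewrite ?addr0 // => m _; rewrite ip0r.
Qed.

End Factorization.

(** * Positive square roots *)

Section PositiveOperators.
Context {R : realType}.

Lemma conj_real (c : R[i]%C) : c^* = c -> c = (complex.Re c)%:C%C.
Proof. by case: c => a b [] /= h; congr Complex; lra. Qed.

Lemma conjC_rc (x : R) : (x%:C%C : R[i]%C)^* = x%:C%C.
Proof. exact: conjc_real. Qed.

Lemma ge0_Re (c : R[i]%C) : 0 <= c -> c = (complex.Re c)%:C%C /\ 0 <=
  complex.Re c.
Proof. by case: c => a b; rewrite lecE /= => /andP[/eqP -> ->]. Qed.

Variable H : hilbertType R.

Definition symmetric_op (A : H -> H) := forall x y, ip (A x) y = ip x (A y).

Definition positive_op (A : H -> H) := forall x, 0 <= ip x (A x).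

(** Complex polarization: <x, A x> is real, and comparing both sides at x + c y gives c s + c^* t =
    0; the values c = 1 and c = i leave only s = 0. *)
Lemma positive_symmetric (A : H -> H) :
  linear A -> positive_op A -> symmetric_op A.
Proof.
move=> linA posA.
have Axx x : ip (A x) x = ip x (A x).
  have [E _] := ge0_Re (posA x).
  by rewrite ip_conj E conjC_rc.
move=> x y; pose s := ip (A x) y - ip x (A y).
pose t := ip (A y) x - ip y (A x).
have st (c : R[i]%C) : c * s + c^* * t = 0.
  have := Axx (x + c *: y); rewrite (linD linA) (linZ linA).
  rewrite !(ipDl, ipDr) !(ipZl, ipZr) !Axx /s /t => E.
  move/eqP: E; rewrite -subr_eq0 => /eqP E; rewrite -[RHS]E; ring.
have h1 := st 1; have h2 := st 'i%C.
have : s = 0.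
  move: h1 h2; case: (s) (t) => [a b] [c d] [/= p1 p2] [/= p3 p4].
  by congr Complex; lra.
by move/eqP; rewrite subr_eq0 => /eqP.
Qed.

(** Positivity is tested at x - A x / M: the cross terms give -2 |A x|^2 / M, and the quadratic term
    is at most |A x|^2 / M by the bound on [A]. This is what makes 1 - A/M a contraction in
    [positive_sqrt]. *)
Lemma positive_op_le (A : H -> H) (M : R) : linear A -> op_bound M A ->
  positive_op A -> 0 < M ->
  forall x, rn (A x) ^+ 2 <= M * complex.Re (ip x (A x)).
Proof.
move=> linA AM posA M0 x; have symA := positive_symmetric linA posA.
have [_] := ge0_Re (posA (x - M^-1%:C%C *: A x)).
rewrite (linB linA) (linZ linA) !(ipBl, ipBr) !(ipZl, ipZr) symA.
rewrite !conjC_rc.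
have AAx : rn (ip (A x) (A (A x)) : R[i]%C) <= M * rn (A x) ^+ 2.
  apply: le_trans (ip_le_rn _ _) _; rewrite mulrC expr2 mulrA.
  by rewrite ler_wpM2r ?rn_ge0.
have := le_trans (Re_le_rn _) AAx.
rewrite (symA x (A (A x))).
have -> : ip x (A (A x)) = (rn (A x) ^+ 2)%:C%C by rewrite -symA ip_rn.
case: (ip x (A x)) => a b; case: (ip x (A (A (A x)))) => c d /=.
set n := rn (A x) ^+ 2.
rewrite ?mul0r ?mulr0 ?subr0 => cM h.
have : 0 <= a - M^-1 * n.
  have : M^-1 * (M^-1 * c) <= M^-1 * n by rewrite ler_pM2l ?invr_gt0 //
    ler_pdivrMl.
  by move: h; lra.
by rewrite subr_ge0 ler_pdivrMl.
Qed.

End PositiveOperators.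

Section SquareRoot.
Context {R : realType}.
Variables (H : hilbertType R) (B : H -> H).
Hypotheses (linB : linear B) (B1 : op_bound 1 B) (symB : symmetric_op B).

(* [X] is a polynomial in [B] with nonnegative coefficients of sum [r]. *)
Inductive nneg_poly : R -> (H -> H) -> Prop :=
| NnegGen : nneg_poly 1 B
| NnegZ c r X : 0 <= c -> nneg_poly r X ->
    nneg_poly (c * r) (fun h => c%:C%C *: X h)
| NnegD r s X Y : nneg_poly r X -> nneg_poly s Y ->
    nneg_poly (r + s) (fun h => X h + Y h)
| NnegM r s X Y : nneg_poly r X -> nneg_poly s Y ->
    nneg_poly (r * s) (fun h => X (Y h)).

Lemma nneg_poly_ge0 r X : nneg_poly r X -> 0 <= r.
Proof. by elim=> // *; rewrite ?ler01 ?addr_ge0 ?mulr_ge0. Qed.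

Lemma nneg_poly_linear r X : nneg_poly r X -> linear X.
Proof.
elim=> // [c s {}X _ _ lX|s t {}X Y _ lX _ lY|s t {}X Y _ lX _ lY] a u v /=.
- by rewrite lX scalerDr !scalerA mulrC.
- by rewrite lX lY scalerDr addrACA.
- by rewrite lY lX.
Qed.

Lemma nneg_poly_bound r X : nneg_poly r X -> op_bound r X.
Proof.
elim=> // [c s {}X c0 _ hX|s t {}X Y _ hX _ hY|s t {}X Y hs hX _ hY] h.
- by rewrite rnZ rn_real ger0_norm // -mulrA ler_wpM2l.
- by rewrite mulrDl; apply: le_trans (rnD _ _) (lerD _ _).
- apply: le_trans (hX _) _; rewrite -mulrA ler_wpM2l //.
  exact: nneg_poly_ge0 hs.
Qed.

Lemma nneg_poly_commute (Z : H -> H) r X : linear Z ->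
  (forall h, Z (B h) = B (Z h)) -> nneg_poly r X ->
  forall h, Z (X h) = X (Z h).
Proof.
move=> lZ ZB; elim=> // [c s {}X _ _ hX|s t {}X Y _ hX _ hY|s t {}X Y _ hX _
  hY] h.
- by rewrite (linZ lZ) hX.
- by rewrite (linD lZ) hX hY.
- by rewrite hX hY.
Qed.

Lemma nneg_poly_commute2 r X s Y : nneg_poly r X -> nneg_poly s Y ->
  forall h, X (Y h) = Y (X h).
Proof.
move=> hX hY; apply: nneg_poly_commute hY; first exact: nneg_poly_linear hX.
by move=> h; rewrite (nneg_poly_commute linB _ hX).
Qed.

Lemma nneg_poly_symmetric r X : nneg_poly r X -> symmetric_op X.
Proof.
elim=> // [c s {}X _ _ hX|s t {}X Y _ hX _ hY|s t {}X Y pX hX pY hY] x y.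
- by rewrite ipZl ipZr hX conjC_rc.
- by rewrite ipDl ipDr hX hY.
- by rewrite hX hY (nneg_poly_commute2 pX pY).
Qed.

(* The iterates converge to the solution [Y = 1 - (1 - B)^{1/2}] of
   [Y = (B + Y^2) / 2]; [sqrt_sum n] is the sum of the coefficients of
   [sqrt_iter n] as a polynomial in [B]. *)
Fixpoint sqrt_iter (n : nat) (h : H) : H :=
  if n is m.+1 then
    2^-1%:C%C *: (B h + sqrt_iter m (sqrt_iter m h)) else 2^-1%:C%C *: B h.

Fixpoint sqrt_sum (n : nat) : R :=
  if n is m.+1 then 2^-1 * (1 + sqrt_sum m * sqrt_sum m) else 2^-1 * 1.

Lemma sqrt_iterP n : nneg_poly (sqrt_sum n) (sqrt_iter n).
Proof.
elim: n => [|n IH]; first by apply: NnegZ; [rewrite invr_ge0|exact: NnegGen].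
apply: NnegZ; first by rewrite invr_ge0.
by apply: NnegD; [exact: NnegGen|exact: NnegM].
Qed.

(** Since the iterates commute, a difference of squares factors: the next increment is half the
    product of the current increment and a sum of iterates, so nonnegativity of the coefficients
    propagates. As [B] is a contraction, the operator increments are then dominated by those of the
    bounded monotone scalar sequence [sqrt_sum]. *)
Lemma sqrt_iterSB n :
  nneg_poly (sqrt_sum n.+1 - sqrt_sum n)
    (fun h => sqrt_iter n.+1 h - sqrt_iter n h).
Proof.
have i2 : 0 <= 2^-1 :> R by rewrite invr_ge0.
elim: n => [|n IH].
  pose X0 := (fun h => 2^-1%:C%C *: (sqrt_iter 0 (sqrt_iter 0 h))).
  rewrite (_ : (fun h => _) = X0); last first.
    by apply/funext => h /=; rewrite -scalerBr addrAC subrr add0r.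
  rewrite (_ : _ - _ = 2^-1 * (sqrt_sum 0 * sqrt_sum 0)).
    by apply: NnegZ => //; apply: NnegM; exact: sqrt_iterP.
  by rewrite /=; field.
set X' := sqrt_iter n.+1 in IH *; set X := sqrt_iter n in IH *.
set r' := sqrt_sum n.+1 in IH *; set r := sqrt_sum n in IH *.
have pX : nneg_poly r X by exact: sqrt_iterP.
have pX' : nneg_poly r' X' by exact: sqrt_iterP.
have E1 : sqrt_sum n.+2 - r' = 2^-1 * ((r' - r) * (r' + r)).
  by rewrite /r' /r /=; field.
have E2 h : sqrt_iter n.+2 h - X' h =
    2^-1%:C%C *: (X' (X' h + X h) - X (X' h + X h)).
  transitivity (2^-1%:C%C *: (B h + X' (X' h)) - 2^-1%:C%C *: (B h + X (X h))).
    by [].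
  rewrite -scalerBr; congr (_ *: _); clear IH; clearbody X X' r r'.
  rewrite (linD (nneg_poly_linear pX')) (linD (nneg_poly_linear pX)).
  rewrite -(nneg_poly_commute2 pX' pX) [in RHS]opprD addrA addrK.
  by rewrite opprD addrACA subrr add0r.
rewrite -/r' E1 (_ : (fun h => _) = (fun h => 2^-1%:C%C *:
    (X' (X' h + X h) - X (X' h + X h)))); last exact/funext.
apply: NnegZ => //.
by apply: (NnegM IH); exact: NnegD.
Qed.

End SquareRoot.

Section SquareRootLimit.
Context {R : realType}.
Variables (H : hilbertType R) (B : H -> H).
Hypotheses (lB : linear B) (B1 : op_bound 1 B) (symB : symmetric_op B).

Lemma sqrt_sum_bound n : (0 <= @sqrt_sum R n <= 1)%R.
Proof.
elim: n => [|n /andP[IH0 IH1]] /=; first by apply/andP; split; lra.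
have h1 : 0 <= @sqrt_sum R n * sqrt_sum n by rewrite mulr_ge0.
have h2 : @sqrt_sum R n * sqrt_sum n <= 1 by rewrite mulr_ile1.
by apply/andP; split; lra.
Qed.

Lemma sqrt_iter_dist m n h : (m <= n)%N ->
  rn (sqrt_iter B m h - sqrt_iter B n h) <= (sqrt_sum n - sqrt_sum m) * rn h.
Proof.
elim: n => [|n IH].
  by rewrite leqn0 => /eqP ->; rewrite !subrr rn0 mul0r.
rewrite leq_eqVlt => /predU1P[->|]; first by rewrite !subrr rn0 mul0r.
rewrite ltnS => /IH {}IH.
apply: le_trans (rn_triangle (sqrt_iter B n h) _ _) _.
have -> : (sqrt_sum n.+1 - sqrt_sum m) * rn h =
  (sqrt_sum n - sqrt_sum m) * rn h + (sqrt_sum n.+1 - sqrt_sum n) * rn h by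
    ring.
apply: lerD => //; rewrite rnBC.
exact: (nneg_poly_bound B1 (sqrt_iterSB lB n) h).
Qed.

Lemma sqrt_iter_cvg h : cvgn (fun n => sqrt_iter B n h).
Proof.
have nds : nondecreasing_seq (@sqrt_sum R).
  apply/nondecreasing_seqP => n; rewrite -subr_ge0.
  exact: nneg_poly_ge0 (sqrt_iterSB lB n).
have cs : cvgn (@sqrt_sum R).
  apply: nondecreasing_is_cvgn => //; exists 1 => _ [n _ <-].
  by case/andP: (sqrt_sum_bound n).
apply: (@rn_cauchy _ _ _ (fun n => (limn sqrt_sum - sqrt_sum n) * rn h)).
  move=> m n mn; apply: le_trans (sqrt_iter_dist _ mn) _.
  rewrite ler_wpM2r ?rn_ge0 // lerD2r.
  exact: nondecreasing_cvgn_le.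
rewrite -[X in _ --> X](mul0r (rn h)); apply: cvgM; last exact: cvg_cst.
by rewrite -[X in _ --> X](subrr (limn sqrt_sum)); apply: cvgB => //; exact:
  cvg_cst.
Qed.

(** P = 1 - Y works: Y^2 + B = 2 Y gives P^2 = 1 - 2 Y + Y^2 = 1 - B, and P is positive because Y is
    a symmetric contraction. The bound 2 is the triangle inequality. *)
Lemma contraction_sqrt : exists P : H -> H,
  [/\ linear P, op_bound 2 P, positive_op P & forall h, P (P h) = h - B h].
Proof.
pose X := sqrt_iter B; pose Y h := limn (fun n => X n h).
have XY h : X n h @[n --> \oo] --> Y h by exact: sqrt_iter_cvg.
have X1 n : op_bound 1 (X n).
  move=> h; apply: le_trans (nneg_poly_bound B1 (sqrt_iterP B n) h) _.
  by rewrite ler_wpM2r ?rn_ge0 //; case/andP: (sqrt_sum_bound n).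
have linX n : linear (X n) by exact: nneg_poly_linear (sqrt_iterP B n).
have linY : linear Y.
  move=> c u v; apply: cvg_eqc (XY _) _.
  under eq_fun do rewrite linX.
  by apply: cvgD; [apply: cvgZl_tmp|].
have Y1 : op_bound 1 Y.
  by move=> h; apply: cvg_rn_le (XY h) _; apply: nearW => n; exact: X1.
have symY : symmetric_op Y.
  move=> u v.
  have h1 : (ip (X n u) v : cplx R) @[n --> \oo] --> (ip (Y u) v : cplx R).
    by apply: cvg_ip => //; exact: cvg_cst.
  have h2 : (ip u (X n v) : cplx R) @[n --> \oo] --> (ip u (Y v) : cplx R).
    by apply: cvg_ip => //; exact: cvg_cst.
  apply: (cvg_eqc h1); move: h2.
  rewrite (_ : (fun n => ip u (X n v)) = (fun n => ip (X n u) v)) //.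
  by apply/funext => n; rewrite (nneg_poly_symmetric lB symB (sqrt_iterP B n)).
have XXY h : X n (X n h) @[n --> \oo] --> Y (Y h).
  apply: (@cvg_rn0_le _ _ _ _ _ _ _
    (fun n => rn (X n h - Y h) + rn (X n (Y h) - Y (Y h)))).
    apply: nearW => n; apply: le_trans (rn_triangle (X n (Y h)) _ _) _.
    rewrite lerD2r -(linB (linX n)).
    by apply: le_trans (X1 n _) _; rewrite mul1r.
  rewrite -[X in _ --> X](addr0 0).
  by apply: cvgD; apply/cvg_rnP.
have YE h : B h + Y (Y h) = 2 *: Y h.
  have h1 : X n.+1 h @[n --> \oo] --> Y h.
    by have := XY h; rewrite -(cvg_shiftS (fun n => X n h)).
  have h2 : 2^-1%:C%C *: (B h + X n (X n h)) @[n --> \oo] -->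
      2^-1%:C%C *: (B h + Y (Y h)).
    by apply: cvgZl_tmp; apply: cvgD => //; exact: cvg_cst.
  rewrite [in RHS](cvg_eqc h1 h2) scalerA.
  have -> : 2 = 2%:C%C :> R[i]%C by rewrite rmorph_nat.
  by rewrite -rmorphM divff ?pnatr_eq0 // rmorph1 scale1r.
exists (fun h => h - Y h); split.
- by move=> c u v; rewrite linY scalerBr opprD addrACA.
- by move=> h; apply: le_trans (rnB _ _) _; have := Y1 h; lra.
- move=> h; rewrite ipBr ip_rn subr_ge0.
  rewrite (conj_real (_ : (ip h (Y h))^* = _)); last by rewrite -ip_conj symY.
  rewrite lecR; apply: le_trans (Re_le_rn _) _.
  apply: le_trans (ip_le_rn _ _) _; rewrite expr2 ler_wpM2l ?rn_ge0 //.
  by have := Y1 h; rewrite mul1r.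
- move=> h; rewrite (linB linY) -[B h](addrK (Y (Y h))) YE.
  by rewrite scaler_nat mulr2n !opprD !opprK !addrA.
Qed.

End SquareRootLimit.

Lemma positive_sqrt (R : realType) (H : hilbertType R) (A : H -> H) (M : R) :
  linear A -> 0 < M -> op_bound M A -> positive_op A ->
  exists P : H -> H,
    [/\ linear P, exists2 C, 0 < C & op_bound C P, positive_op P &
        forall h, P (P h) = A h].
Proof.
move=> linA M0 AM posA; pose B h := h - M^-1%:C%C *: A h.
have lB : linear B.
  move=> c u v; by rewrite /B linA scalerBr scalerDr !scalerA (mulrC c) opprD
    addrACA.
have symA := positive_symmetric linA posA.
have symB : symmetric_op B.
  by move=> x y; rewrite ipBl ipBr ipZl ipZr conjC_rc symA.
(* With a = <h, A h>, the square of |B h| is |h|^2 - 2a/M + |A h|^2/M^2, and [positive_op_le] bounds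
   the last term by a/M. *)
have B1 : op_bound 1 B.
  move=> h; rewrite mul1r -(@ler_pXn2r _ 2) ?nnegrE ?rn_ge0 // /B.
  rewrite rnB_sqr rnZ rn_real exprMn real_normK ?num_real // ipZr.
  have := positive_op_le linA AM posA M0 h.
  have [E] := ge0_Re (posA h); rewrite E; move: (complex.Re (ip h (A h))) => a.
  rewrite /= mulr0 subr0 => a0; move: (rn (A h) ^+ 2) (rn h ^+ 2) => n m na.
  have : M^-1 ^+ 2 * n <= M^-1 * a.
    by rewrite expr2 -mulrA ler_pM2l ?invr_gt0 // ler_pdivrMl.
  have : 0 <= M^-1 * a by rewrite mulr_ge0 // invr_ge0 ltW.
  lra.
have [P [lP P2 posP PP]] := contraction_sqrt lB B1 symB.
have s0 : 0 <= Num.sqrt M by exact: sqrtr_ge0.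
exists (fun h => (Num.sqrt M)%:C%C *: P h); split.
- by move=> c u v; rewrite lP scalerDr !scalerA mulrC.
- exists (Num.sqrt M * 2) => [|h]; first by rewrite mulr_gt0 ?sqrtr_gt0.
  by rewrite rnZ rn_real ger0_norm // -mulrA ler_wpM2l.
- by move=> h; rewrite ipZr mulr_ge0 // lecR.
- move=> h; rewrite (linZ lP) scalerA -rmorphM -expr2 sqr_sqrtr ?ltW // PP.
  rewrite /B opprB addrC subrK scalerA -rmorphM divff ?gt_eqF //.
  by rewrite rmorph1 scale1r.
Qed.

(** * The Hardy space *)

Section HardySpace.
Context {R : realType}.
Implicit Types g h : hardy R.

Lemma rn_hardy h : rn h = Num.sqrt (sqnorm h).
Proof. by rewrite /rn hardy_normE. Qed.

Lemma rn_sqnorm h : rn h ^+ 2 = sqnorm h.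
Proof. by rewrite rn_hardy sqr_sqrtr // sqnorm_ge0. Qed.

Lemma sqmod_rn (z : cplx R) : sqmod z = rn z ^+ 2.
Proof. by apply: complexI; rewrite -norm_sqmod rnE rmorphXn. Qed.

Lemma ip_hardyE g h : ip g h = hardy_ip g h.
Proof. by []. Qed.

Lemma ip_monomial n h : ip (monomial n) h = taylor h n.
Proof.
rewrite ip_hardyE; apply: hardy_ipE.
apply: (@cvg_near_cst _ (cplx R)); exists n.+1 => // N /= nN.
rewrite /series /= (big_cat_nat (n := n.+1)) //= big_nat_recr //=.
rewrite big_nat_cond big1; last first.
  move=> i /andP[/andP[_ ni] _].
  by rewrite taylor_monomial (ltn_eqF ni) rmorph0 mul0r.
rewrite add0r big_nat_cond big1; last first.
  move=> i /andP[/andP[ni _] _].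
  by rewrite taylor_monomial (gtn_eqF ni) rmorph0 mul0r.
by rewrite addr0 taylor_monomial eqxx rmorph1 mul1r.
Qed.

Definition trunc (N : nat) h : hardy R :=
  \sum_(0 <= k < N) ip (monomial k) h *: monomial k.

Lemma linear_trunc N : linear (trunc N).
Proof.
move=> c g h; rewrite /trunc scaler_sumr -big_split /=.
by apply: eq_bigr => k _; rewrite ip_linear scalerDl scalerA.
Qed.

Lemma ip_trunc N g h :
  ip g (trunc N h) = \sum_(0 <= k < N) ip g (monomial k) * ip (monomial k) h.
Proof.
by rewrite ip_sumr; apply: eq_bigr => k _; rewrite ipZr mulrC.
Qed.

Lemma ip_trunc_diag N h : ip h (trunc N h) = (psum (taylor h) N)%:C%C.
Proof.
rewrite ip_trunc /psum /series /= rmorph_sum; apply: eq_bigr => k _.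
by rewrite ip_conj mulrC mulcJ ip_monomial sqmod_rn.
Qed.

Lemma ip_monomial_sum (u : nat -> R[i]%C) N k :
  ip (monomial k) (\sum_(0 <= j < N) u j *: monomial j) =
  if (k < N)%N then u k else 0.
Proof.
rewrite ip_sumr.
under eq_bigr do rewrite ipZr ip_monomial taylor_monomial.
case: ltnP => kN.
  rewrite big_mkord (bigD1 (Ordinal kN)) //= eqxx mulr1 big1 ?addr0 // => i ik.
  by rewrite (_ : (k == i) = false) ?mulr0 //; apply/negbTE; rewrite eq_sym.
rewrite big_nat_cond big1 // => i /andP[/andP[_ iN] _].
by rewrite (gtn_eqF (leq_trans iN kN)) mulr0.
Qed.

Lemma rn_monomial_sum (u : nat -> R[i]%C) N :
  rn (\sum_(0 <= j < N) u j *: (monomial j : hardy R)) ^+ 2 =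
  \sum_(0 <= j < N) rn (u j) ^+ 2.
Proof.
rewrite rn_sqr [in X in ip _ X]big_nat_cond ip_sumr raddf_sum [RHS]big_nat_cond.
apply: eq_bigr => k /andP[/andP[_ kN] _].
by rewrite ipZr ip_conj ip_monomial_sum kN mulcJ.
Qed.

Lemma rn_trunc_sqr N h : rn (trunc N h) ^+ 2 = psum (taylor h) N.
Proof.
rewrite rn_monomial_sum; apply: eq_bigr => k _.
by rewrite sqmod_rn ip_monomial.
Qed.

Lemma trunc_bound N : op_bound 1 (trunc N).
Proof.
move=> h; rewrite mul1r -(@ler_pXn2r _ 2) ?nnegrE ?rn_ge0 //.
by rewrite rn_trunc_sqr rn_sqnorm psum_le.
Qed.

Lemma rn_trunc_dist N h :
  rn (trunc N h - h) ^+ 2 = rn h ^+ 2 - psum (taylor h) N.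
Proof.
by rewrite rnBC rnB_sqr ip_trunc_diag rn_trunc_sqr /=; ring.
Qed.

Lemma cvg_trunc h : trunc N h @[N --> \oo] --> h.
Proof.
apply: (@cvg_rn0_le _ _ _ _ _ _ _
  (fun N => Num.sqrt (rn h ^+ 2 - psum (taylor h) N))).
  apply: nearW => N; rewrite -(rn_trunc_dist N h) sqrtr_sqr.
  by rewrite ger0_norm ?rn_ge0.
rewrite -[X in _ --> X](@sqrtr0 R); apply: continuous_cvg.
  exact: sqrt_continuous.
rewrite -[X in _ --> X](subrr (rn h ^+ 2)); apply: cvgB; first exact: cvg_cst.
by rewrite rn_sqnorm; exact: psum_cvg.
Qed.

Lemma hardy_ext g h : (forall n, ip (monomial n) g = ip (monomial n) h) -> g =
  h.
Proof.
move=> gh; apply: val_inj; apply/funext => n.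
by have := gh n; rewrite !ip_monomial.
Qed.

Section Adjoint.
Variables (K : hilbertType R) (A : hardy R -> K) (C : R).
Hypotheses (lA : linear A) (C0 : 0 <= C) (hA : op_bound C A).

(** Riesz representation in coordinates: the coefficients of [g] are forced to be [u]. They are
    square summable by duality, for testing against the truncation x of [u] gives |x|^2 = <y, A x>,
    hence |x| at most C |y|. *)
Lemma adjoint_exists y : exists g : hardy R, forall x, ip g x = ip y (A x).
Proof.
pose u n : cplx R := (ip y (A (monomial n)))^*.
have AE (x : nat -> cplx R) N :
    ip y (A (\sum_(0 <= k < N) x k *: monomial k)) =
    \sum_(0 <= k < N) (u k)^* * x k.
  rewrite (lin_sum lA) ip_sumr; apply: eq_bigr => k _.
  by rewrite (linZ lA) ipZr /u conjCK mulrC.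
have us : u \in square_summable.
  apply/square_summableP; exists ((rn y * C) ^+ 2) => N.
  pose x : hardy R := \sum_(0 <= k < N) u k *: monomial k.
  have xE : rn x ^+ 2 = psum u N.
    by rewrite rn_monomial_sum; apply: eq_bigr => k _; rewrite sqmod_rn.
  have : psum u N <= rn y * C * rn x.
    have -> : psum u N = rn (ip y (A x) : cplx R).
      rewrite AE.
      rewrite (_ : \sum_(0 <= k < N) _ = (psum u N)%:C%C :> cplx R).
        rewrite rn_real ger0_norm //; apply: sumr_ge0 => k _.
        exact: sqmod_ge0.
      rewrite /psum /series /= rmorph_sum; apply: eq_bigr => k _.
      by rewrite mulrC mulcJ sqmod_rn.
    apply: le_trans (ip_le_rn _ _) _.
    by rewrite -mulrA ler_wpM2l ?rn_ge0.
  rewrite -xE => h; rewrite ler_pXn2r ?nnegrE ?mulr_ge0 ?rn_ge0 //.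
  have [x0|x0] := eqVneq (rn x) 0; first by rewrite x0 mulr_ge0 ?rn_ge0.
  by move: h; rewrite expr2 ler_pM2r // lt_neqAle eq_sym x0 rn_ge0.
exists (Hardy us) => x.
have h1 := @hardy_ip_cvg _ (Hardy us) x.
apply: (cvg_eqc h1).
have : (ip y (A (trunc N x)) : cplx R) @[N --> \oo] --> (ip y (A x) : cplx R).
  apply: cvg_ip; first exact: cvg_cst.
  by apply: continuous_cvg; [exact: (op_bound_continuous lA hA)|exact:
    cvg_trunc].
rewrite (_ : (fun N => _) = series (fun n => (taylor (Hardy us) n)^* * taylor x
  n)) //.
apply/funext => N; rewrite AE; apply: eq_bigr => k _.
by rewrite ip_monomial.
Qed.

Lemma adjointP x y : ip (adjoint A y) x = ip y (A x).
Proof.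
have /choice[B BP] := adjoint_exists.
have : exists B : K -> hardy R, forall x y, ip (B y) x = ip y (A x).
  by exists B.
rewrite /adjoint; move=> /(@xgetPex _ (cst 0)); exact.
Qed.

Lemma adjointPr x y : ip x (adjoint A y) = ip (A x) y.
Proof. by rewrite ip_conj adjointP -ip_conj. Qed.

Lemma adjoint_linear : linear (adjoint A).
Proof.
move=> c u v; apply: ip_extl => x.
by rewrite ipDl ipZl !adjointP ipDl ipZl.
Qed.

Lemma adjoint_bound : op_bound C (adjoint A).
Proof.
move=> y; have [a0|a0] := eqVneq (rn (adjoint A y)) 0.
  by rewrite a0 mulr_ge0 ?rn_ge0.
have ap : 0 < rn (adjoint A y) by rewrite lt_neqAle eq_sym a0 rn_ge0.
rewrite -(ler_pM2r ap) -expr2 -[leLHS]ger0_norm ?sqr_ge0 // -rn_real -ip_rn.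
rewrite adjointP; apply: le_trans (ip_le_rn _ _) _.
by rewrite mulrC -mulrA mulrCA [leRHS]mulrC ler_wpM2r ?rn_ge0 // mulrC.
Qed.

End Adjoint.

End HardySpace.

Local Opaque szego rn hardy_ip.

(** * Continuity and totality of the Szego kernels *)

Section SzegoKernels.
Context {R : realType}.
Implicit Types (z w : cplx R) (h : hardy R).

Lemma disk_rn z : disk z -> rn z < 1.
Proof. by rewrite /disk /= rnE -[1]/(1%:C%C) ltcR. Qed.

Lemma one_sub_neq0 z w : disk z -> disk w -> 1 - z * w^* != 0.
Proof.
move=> /disk_rn z1 /disk_rn w1; rewrite subr_eq0; apply/eqP => E.
have : rn (1 : R[i]%C) = rn (z * w^*) by rewrite E.
rewrite rnM rn_conj rn1 => E1.
have : rn z * rn w < 1 by rewrite mulr_ilt1 ?rn_ge0.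
by rewrite -E1 ltxx.
Qed.

Lemma ip_szego z w : disk z -> disk w ->
  ip (szego z) (szego w) = (1 - z * w^*)^-1.
Proof. by move=> z1 w1; rewrite szego_reproducing // hardy_eval_szego. Qed.

Section Limits.
Context {T : Type} {F : set_system T} {FF : Filter F}.

Lemma cvg_conj (u : T -> cplx R) (l : cplx R) :
  u x @[x --> F] --> l -> ((u x)^* : cplx R) @[x --> F] --> (l^* : cplx R).
Proof.
move=> /cvg_rnP ul; apply/cvg_rnP.
by under eq_fun do rewrite -rmorphB /= rn_conj.
Qed.

Lemma cvg_Re (u : T -> cplx R) (l : cplx R) :
  u x @[x --> F] --> l -> complex.Re (u x) @[x --> F] --> complex.Re l.
Proof.
move=> /cvg_rnP ul; apply/cvgrPdist_le => e e0.
move/cvgrPdist_le : ul => /(_ e e0); apply: filterS => x.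
rewrite sub0r normrN ger0_norm ?rn_ge0 //; apply: le_trans.
have := Re_le_rn (u x - l); have := Re_le_rn (l - u x).
rewrite (rnBC l) ler_norml !raddfB /= => *.
by apply/andP; split; lra.
Qed.

Lemma cvg_mulc (u v : T -> cplx R) (a b : cplx R) :
  u x @[x --> F] --> a -> v x @[x --> F] --> b ->
  (u x * v x : cplx R) @[x --> F] --> (a * b : cplx R).
Proof.
move=> ua vb; have /cvg_rnP ua' := ua; have /cvg_rnP vb' := vb.
apply: (@cvg_rn0_le _ _ _ _ _ _ _
  (fun x => rn (u x - a) * rn (v x) + rn a * rn (v x - b))).
  apply: nearW => x.
  rewrite (_ : u x * v x - a * b = (u x - a) * v x + a * (v x - b)).
    by apply: le_trans (rnD _ _) _; rewrite !rnM.
  by rewrite mulrBl mulrBr addrA subrK.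
rewrite (_ : 0 = 0 * rn b + rn a * 0); last by rewrite mul0r mulr0 addr0.
apply: cvgD; apply: cvgM.
- exact: ua'.
- exact: (cvg_rn vb).
- exact: cvg_cst.
- exact: vb'.
Qed.

Lemma cvg_congr (f g : T -> cplx R) (l m : cplx R) :
  (forall x, f x = g x) -> l = m -> g x @[x --> F] --> m -> f x @[x --> F] -->
    l.
Proof. by move=> /funext -> ->. Qed.

Lemma cvg_ip_szego (u v : T -> cplx R) (a b : cplx R) :
  (forall x, disk (u x)) -> (forall x, disk (v x)) -> disk a -> disk b ->
  u x @[x --> F] --> a -> v x @[x --> F] --> b ->
  (ip (szego (u x)) (szego (v x)) : cplx R) @[x --> F] -->
  (ip (szego a) (szego b) : cplx R).
Proof.
move=> u1 v1 a1 b1 ua vb.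
apply: cvg_congr (fun x => ip_szego (u1 x) (v1 x)) (ip_szego a1 b1) _.
apply: cvgV; first exact: one_sub_neq0.
apply/cvg_rnP.
have /cvg_rnP : (u x * (v x)^* : cplx R) @[x --> F] --> (a * b^* : cplx R).
  by apply: cvg_mulc ua _; exact: cvg_conj.
rewrite (_ : (fun x => rn (u x * _ - _)) =
  (fun x => rn (1 - u x * (v x)^* - (1 - a * b^*)))) //.
by apply/funext => x; rewrite rnBC; congr rn; rewrite opprB [RHS]addrC addrA
  subrK.
Qed.

(** The squared distance of two kernels expands into entries of their Gram function, which is
    explicit and continuous on the disk. *)
Lemma cvg_szego (u : T -> cplx R) (a : cplx R) :
  (forall x, disk (u x)) -> disk a -> u x @[x --> F] --> a ->
  szego (u x) @[x --> F] --> szego a.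
Proof.
move=> u1 a1 ua.
have ca : (cst a x : cplx R) @[x --> F] --> a by exact: cvg_cst.
have h1 := cvg_Re (cvg_ip_szego u1 u1 a1 a1 ua ua).
have h2 := cvg_Re (cvg_ip_szego u1 (fun=> a1) a1 a1 ua ca).
pose i := complex.Re (ip (szego a) (szego a)).
have h : rn (szego (u x) - szego a) ^+ 2 @[x --> F] --> (0 : R).
  rewrite (funext (fun x => rnB_sqr_ip (szego (u x)) (szego a))).
  rewrite (_ : 0 = i - 2 * i + i); last ring.
  apply: cvgD; last exact: cvg_cst.
  apply: cvgB; first exact: h1.
  by apply: cvgM; [exact: cvg_cst|exact: h2].
apply/cvg_rnP; rewrite -(@sqrtr0 R).
rewrite (_ : (fun x => rn _) = (fun x => Num.sqrt (rn (szego (u x) - szego a)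
  ^+ 2))).
  by apply: continuous_cvg => //; exact: sqrt_continuous.
by apply/funext => x; rewrite sqrtr_sqr ger0_norm ?rn_ge0.
Qed.

End Limits.

(** The function z |-> (h(z) - h(0))/z. The default 0 is never taken, as a shifted square-summable
    sequence is square summable. *)
Definition backward_shift h : hardy R :=
  insubd 0 (fun n => taylor h n.+1).

Lemma taylor_backward_shift h n : taylor (backward_shift h) n = taylor h n.+1.
Proof.
rewrite /backward_shift (_ : taylor _ = (fun n => taylor h n.+1)) //.
rewrite [LHS]insubdK //; apply/square_summableP; exists (sqnorm h) => N.
apply: le_trans (psum_le h N.+1); rewrite /psum /series /= !big_mkord.
by rewrite big_ord_recl lerDr sqmod_ge0.
Qed.

Local Opaque backward_shift.

Lemma ip_szego_backward_shift w h : disk w ->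
  ip (szego w) h = taylor h 0 + w * ip (szego w) (backward_shift h).
Proof.
move=> w1; have h1 := @hardy_ip_cvg _ (szego w) h.
rewrite -(cvg_shiftS) /= in h1.
apply: (cvg_eqc h1).
have h2 := @hardy_ip_cvg _ (szego w) (backward_shift h).
rewrite (_ : (fun n => _) = (fun n => taylor h 0 +
  w * series (fun n => (taylor (szego w) n)^* * taylor (backward_shift h) n)
    n)).
  apply: cvgD; first exact: cvg_cst.
  by apply: (cvg_mulc _ h2); exact: cvg_cst.
apply/funext => n; rewrite /series /= !big_mkord big_ord_recl mulr_sumr.
rewrite (taylor_szego 0 w1) expr0 rmorph1 mul1r; congr (_ + _).
apply: eq_bigr => i _; rewrite taylor_backward_shift.
rewrite (taylor_szego i w1) (taylor_szego (bump 0 i) w1) /bump /=.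
by rewrite !rmorphXn /= conjCK exprS mulrA.
Qed.

(** An identity theorem by division: a function vanishing off 0 vanishes at 0 by continuity, and
    then dividing by w shows that its backward shift vanishes off 0 too. Iteration kills every
    Taylor coefficient. *)
Lemma szego_total h : (forall w, disk w -> ip (szego w) h = 0) -> h = 0.
Proof.
have disk0 : disk (0 : cplx R) by rewrite /disk /= normr0.
have main g : (forall w, disk w -> w != 0 -> ip (szego w) g = 0) ->
    taylor g 0 = 0 /\
    (forall w, disk w -> w != 0 -> ip (szego w) (backward_shift g) = 0).
  move=> g0; have t0 : taylor g 0 = 0.
    (* Nonzero points tending to 0, starting at 1/2 in order to stay inside the open disk. *)
    pose w n : cplx R := (n.+2%:R^-1)%:C%C.
    have wn n : rn (w n) = n.+2%:R^-1 by rewrite rn_real ger0_norm.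
    have w1 n : disk (w n).
      rewrite /disk /= rnE -[1]/(1%:C%C) ltcR wn.
      by rewrite invf_lt1 // ltr1n.
    have wc : w n @[n --> \oo] --> (0 : cplx R).
      apply: (@cvg_rn0_le _ _ _ _ _ _ _ (fun n => n.+1%:R^-1)).
        apply: nearW => n; rewrite subr0 wn lef_pV2 ?posrE //.
        by rewrite ler_nat.
      exact: cvg_harmonic.
    have := ip_szego_backward_shift g disk0; rewrite mul0r addr0 => <-.
    have h1 : (ip (szego (w n)) g : cplx R) @[n --> \oo] -->
        (ip (szego 0) g : cplx R).
      by apply: cvg_ip; [exact: cvg_szego|exact: cvg_cst].
    apply: (cvg_eqc h1).
    rewrite (_ : (fun n => _) = cst 0); first exact: cvg_cst.
    apply/funext => n; rewrite g0 //; apply/eqP => E.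
    by have := wn n; rewrite E rn0 => /esym/eqP; rewrite invr_eq0 pnatr_eq0.
  split => // w w1 w0; have := g0 w w1 w0.
  rewrite ip_szego_backward_shift // t0 add0r => /eqP.
  by rewrite mulf_eq0 (negbTE w0) => /eqP.
move=> h0; apply: hardy_ext => n; rewrite ip0r ip_monomial.
have : forall w, disk w -> w != 0 -> ip (szego w) h = 0 by move=> w /h0.
elim: n h {h0} => [|n IH] h /main[h0 h1]; first exact: h0.
by rewrite -taylor_backward_shift; exact: IH.
Qed.

(* A closed subspace containing the kernels has trivial orthogonal complement,
   hence is everything. *)
Lemma szego_closed_subspace (N : hardy R -> Prop) :
  (forall w, disk w -> N (szego w)) -> N 0 ->
  (forall c g h, N g -> N h -> N (c *: g + h)) ->
  (forall h, (forall e : R, 0 < e -> exists2 g, N g & rn (h - g) < e) -> N h) ->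
  forall h, N h.
Proof.
move=> Nk N0 Nlin Ncl h; apply: Ncl => e e0.
have [q Nq hq] := orthogonal_decomposition N0 Nlin h.
have q0 : q = 0 by apply: szego_total => w w1; apply: Nq; exact: Nk.
have [g Ng] := hq e e0; rewrite q0 subr0 => gh; exists g; [exact: Ng|exact: gh].
Qed.

End SzegoKernels.

Local Opaque monomial.

(** * Trace-class operators *)

Section Trace.
Context {R : realType}.
Implicit Types A B S rho : hardy R -> hardy R.

(** The function [trace] is a [limn], whose value means nothing without convergence; the relation
    carries the convergence along. *)
Definition has_trace A (l : R[i]%C) :=
  series (fun n => ip (monomial n) (A (monomial n)) : cplx R) n
    @[n --> \oo] --> (l : cplx R).

Lemma has_traceE A l : has_trace A l -> trace A = l.
Proof. by move=> Al; apply: (cvg_lim _ Al); exact: norm_hausdorff. Qed.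

Lemma has_traceB A B l m c : has_trace A l -> has_trace B m ->
  has_trace (fun h => A h - c *: B h) (l - c * m).
Proof.
move=> Al Bm; apply: (@cvg_congr _ _ _ _ (fun n =>
  series (fun n => ip (monomial n) (A (monomial n)) : cplx R) n -
  c *: series (fun n => ip (monomial n) (B (monomial n)) : cplx R) n)
  _ ((l : cplx R) - c *: (m : cplx R))); [|exact: erefl|].
  move=> n; rewrite /series /= scaler_sumr -sumrB; apply: eq_bigr => k _.
  by rewrite ipBr ipZr.
apply: cvgB; first exact: Al.
by apply: cvgZl_tmp; exact: Bm.
Qed.

(** The partial sums of the trace are <v, S u_n> with u_n the truncation of [u], so continuity of
    [S] suffices. *)
Lemma has_trace_ketbra (u v : hardy R) S (C : R) :
  linear S -> op_bound C S -> has_trace (ketbra u v \o S) (ip v (S u)).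
Proof.
move=> lS hS; apply: (@cvg_congr _ _ _ _ (fun n => ip v (S (trunc n u))) _
  (ip v (S u))); [|exact: erefl|].
  move=> n; rewrite /series /trunc /= (lin_sum lS) ip_sumr.
  by apply: eq_bigr => k _; rewrite /ketbra ipZr (linZ lS) ipZr mulrC.
apply: cvg_ip; first exact: cvg_cst.
by apply: continuous_cvg; [exact: (op_bound_continuous lS hS)|exact: cvg_trunc].
Qed.

(* [rho = \sum_j |x_j><y_j|]. *)
Definition nuclear (x y : nat -> hardy R) rho :=
  [/\ cvgn (series (fun j => rn (x j) ^+ 2)),
      cvgn (series (fun j => rn (y j) ^+ 2)) &
      forall h, series (fun j => ip (y j) h *: x j) n @[n --> \oo] --> rho h].

(** Supplies the summable majorant whenever Tannery's theorem is applied to a nuclear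
    decomposition. *)
Lemma rn_ip_mul_le (C : R) (x y z : hardy R) : 0 <= C -> rn z <= C * rn x ->
  rn (ip y z : cplx R) <= C * (rn x ^+ 2 + rn y ^+ 2).
Proof.
move=> C0 zx; apply: le_trans (ip_le_rn _ _) _.
have y0 := rn_ge0 y.
move: (rn x) (rn y) (rn z) y0 zx => a b c b0 ca.
apply: (@le_trans _ _ (b * (C * a))); first by rewrite ler_wpM2l.
rewrite mulrCA ler_wpM2l //.
by have := sqr_ge0 (a - b); have := sqr_ge0 (a + b); rewrite sqrrB sqrrD; lra.
Qed.

Lemma nuclear_bound_cvg (x y : nat -> hardy R) rho (C : R) : nuclear x y rho ->
  cvgn (series (fun j => C * (rn (x j) ^+ 2 + rn (y j) ^+ 2))).
Proof.
move=> [cx cy _]; rewrite (_ : series _ = (fun n => C *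
  (series (fun j => rn (x j) ^+ 2) n + series (fun j => rn (y j) ^+ 2) n))).
  apply: cvgP; apply: cvgM; first exact: cvg_cst.
  by apply: cvgD; [exact: cx|exact: cy].
by apply/funext => n; rewrite /series /= -big_split mulr_sumr.
Qed.

(** An interchange of two series: the [K]-th partial sum of the trace is the sum over j of <y_j, S
    (trunc K x_j)>, and Tannery's theorem lets [K] tend to infinity under the sum. *)
Lemma nuclear_trace (x y : nat -> hardy R) rho S (C : R) :
  nuclear x y rho -> 0 <= C -> linear S -> op_bound C S ->
  cvgn (series (fun j => ip (y j) (S (x j)) : cplx R)) /\
  has_trace (rho \o S)
    (limn (series (fun j => ip (y j) (S (x j)) : cplx R))).
Proof.
move=> nu C0 lS hS; have cS := op_bound_continuous lS hS.
apply: (@series_dominated_cvg _ nat \oo _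
  (fun K j => ip (y j) (S (trunc K (x j)))) _ _
  (fun j => C * (rn (x j) ^+ 2 + rn (y j) ^+ 2))).
- apply: nearW => K j; apply: rn_ip_mul_le => //.
  apply: le_trans (hS _) _; rewrite ler_wpM2l //.
  by apply: le_trans (trunc_bound K _) _; rewrite mul1r.
(* For fixed [K] the sum over monomials is finite, so it may be exchanged with the series in j that
   defines [rho]. *)
- apply: nearW => K; have [_ _ xy] := nu.
  apply: (@cvg_congr _ _ _ _ (fun n => \sum_(0 <= k < K)
     ip (monomial k) (series (fun j => ip (y j) (S (monomial k)) *: x j) n)) _
     (\sum_(0 <= k < K) ip (monomial k) (rho (S (monomial k))))); [|exact:
       erefl|].
    move=> n; rewrite /series /=.
    under [RHS]eq_bigr do rewrite ip_sumr.
    rewrite exchange_big /=; apply: eq_bigr => j _.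
    rewrite /trunc (lin_sum lS) ip_sumr; apply: eq_bigr => k _.
    by rewrite (linZ lS) !ipZr mulrC.
  apply: (@cvg_fsum _ (cplx R)) => k.
  by apply: cvg_ip; [exact: cvg_cst|exact: xy].
- exact: nuclear_bound_cvg nu.
- move=> j; apply: cvg_ip; first exact: cvg_cst.
  by apply: continuous_cvg; [exact: cS|exact: cvg_trunc].
Qed.

End Trace.

Section TraceClass.
Context {R : realType}.
Implicit Types A rho : hardy R -> hardy R.

Lemma op_absP A : bounded_op A ->
  [/\ bounded_op (op_abs A), positive_op (op_abs A) &
      forall h, op_abs A (op_abs A h) = adjoint A (A h)].
Proof.
move=> /bounded_opP[lA [C C0 hA]]; have C0' := ltW C0.
have lB := adjoint_linear lA C0' hA; have hB := adjoint_bound lA C0' hA.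
have [||||P [lP bP posP PP]] := @positive_sqrt R _ (adjoint A \o A) (C * C).
- exact: linear_comp.
- exact: mulr_gt0.
- exact: op_bound_comp.
- by move=> x; rewrite /= ip_conj (adjointP lA C0' hA) -ip_conj ip_rn lecR
  sqr_ge0.
have : exists P : hardy R -> hardy R, [/\ bounded_op P, forall x, 0 <= ip x (P
  x)
    & P \o P = adjoint A \o A].
  by exists P; split => //; [exact/bounded_opP|exact/funext].
rewrite /op_abs => /(@xgetPex _ (cst 0))[bA pA /funeqP AA].
by split.
Qed.

Lemma rn_op_abs A h : bounded_op A -> rn (op_abs A h) = rn (A h).
Proof.
move=> bA; have [bP posP PP] := op_absP bA.
have [lA [C C0 hA]] := (bounded_opP A).1 bA.
have symP := positive_symmetric bP.1 posP.
apply/eqP; rewrite -(@eqrXn2 _ 2) ?rn_ge0 //; apply/eqP; rewrite !rn_sqr.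
rewrite symP PP Re_ipC (adjointP lA (ltW C0) hA).
by [].
Qed.

Lemma op_abs_polar A : bounded_op A ->
  exists U, [/\ linear U, op_bound 1 U & forall h, U (op_abs A h) = A h].
Proof.
move=> bA; have [bP _ _] := op_absP bA.
by apply: contraction_factorization bP.1 bA.1 _ => h; rewrite rn_op_abs.
Qed.

Lemma op_abs_monomial_ge0 A n : bounded_op A ->
  (0 <= (complex.Re (ip (monomial n) (op_abs A (monomial n))))%:E)%E.
Proof.
by move=> /op_absP[_ posP _]; rewrite lee_fin (ge0_Re (posP _)).2.
Qed.

Lemma trace_class_nuclear rho : trace_class rho ->
  exists x y : nat -> hardy R, nuclear x y rho.
Proof.
move=> [bA trA]; have [bP posP _] := op_absP bA.
have [U [lU U1 UP]] := op_abs_polar bA.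
have [lP [C C0 hP]] := (bounded_opP _).1 bP.
have [Q [lQ [D D0 hQ] posQ QQ]] := positive_sqrt lP C0 hP posP.
have symQ := positive_symmetric lQ posQ.
(* In rho = U Q Q the identity between the two factors [Q] is expanded in monomials. The sum of the
   |y_j|^2 is then the series defining [trace_norm rho], and |x_j| is at most |y_j| because [U] is a
   contraction. *)
pose y j := Q (monomial j); pose x j := U (y j).
have yE j : rn (y j) ^+ 2 =
    complex.Re (ip (monomial j) (op_abs rho (monomial j))).
  by rewrite rn_sqr symQ QQ.
have cy : cvgn (series (fun j => rn (y j) ^+ 2)).
  apply: nondecreasing_is_cvgn.
    by apply: nondecreasing_series => *; exact: sqr_ge0.
  exists (fine (trace_norm rho)) => _ [n _ <-].
  rewrite -lee_fin fineK; last first.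
    rewrite ge0_fin_numE //; apply: nneseries_ge0 => j _ _.
    exact: op_abs_monomial_ge0.
  rewrite /series /= -sumEFin.
  under eq_bigr do rewrite yE.
  by apply: nneseries_lim_ge => j _ _; exact: op_abs_monomial_ge0.
exists x, y; split; [|exact: cy|].
  apply: series_le_cvg cy => [j|j|j]; try exact: sqr_ge0.
  rewrite ler_pXn2r ?nnegrE ?rn_ge0 //.
  by apply: le_trans (U1 _) _; rewrite mul1r.
move=> h; rewrite (_ : rho h = U (Q (Q h))); last by rewrite QQ UP.
rewrite (_ : series _ = (fun n => U (Q (trunc n (Q h))))).
  apply: continuous_cvg; first exact: (op_bound_continuous lU U1).
  apply: continuous_cvg; first exact: (op_bound_continuous lQ hQ).
  exact: cvg_trunc.
apply/funext => n; rewrite /series /trunc /= (lin_sum lQ) (lin_sum lU).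
apply: eq_bigr => j _; rewrite (linZ lQ) (linZ lU); congr (_ *: _).
exact: symQ.
Qed.

(** [A] is only bounded, so the trace of [A \o V], with [V] the adjoint of the polar isometry, is
    not known to converge. With [trunc N] in between it is a sum of [N] convergent inner products,
    whose real part is the [N]-th partial sum of [trace_norm A]. *)
Lemma trace_norm_le A (e : R) : bounded_op A ->
  (forall S, linear S -> op_bound 1 S -> rn (trace (A \o S) : R[i]%C) <= e) ->
  (trace_norm A <= e%:E)%E.
Proof.
move=> bA Ae; have [bP posP _] := op_absP bA.
have [U [lU U1 UP]] := op_abs_polar bA.
have [lA [C C0 hA]] := (bounded_opP _).1 bA.
pose V := adjoint U.
have VP u v : ip (V u) v = ip u (U v) by exact: adjointP lU ler01 U1 _ _.
have lV : linear V by exact: adjoint_linear lU ler01 U1.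
have V1 : op_bound 1 V by exact: adjoint_bound lU ler01 U1.
(* The squared distance expands to |V A h|^2 - 2 |A h|^2 + |A h|^2, since <V A h, |A| h> = <A h, U
   |A| h> = |A h|^2; it is at most 0 because [V] is a contraction. *)
have VUP h : V (A h) = op_abs A h.
  apply/eqP; rewrite -subr_eq0; apply/eqP/rn_eq0/eqP.
  rewrite -sqrf_eq0 eq_le sqr_ge0 andbT rnB_sqr VP UP -rn_sqr rn_op_abs //.
  have : rn (V (A h)) ^+ 2 <= rn (A h) ^+ 2.
    rewrite ler_pXn2r ?nnegrE ?rn_ge0 //.
    by apply: le_trans (V1 _) _; rewrite mul1r.
  lra.
apply: lime_le.
  by apply: is_cvg_nneseries => n _ _; exact: op_abs_monomial_ge0.
apply: nearW => N; rewrite sumEFin lee_fin.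
apply: le_trans (Ae (trunc N \o V) _ _); last 2 first.
- by apply: linear_comp => //; exact: linear_trunc.
- move=> h; apply: le_trans (trunc_bound N _) _.
  by rewrite mul1r; exact: V1.
apply: le_trans (Re_le_rn _); rewrite -raddf_sum.
rewrite (@has_traceE _ _ (\sum_(0 <= j < N) ip (U (monomial j)) (A (monomial
  j)))).
  rewrite !raddf_sum /=; apply: ler_sum => j _.
  by rewrite -VUP Re_ipC VP Re_ipC.
apply: (@cvg_congr _ _ _ _ (fun n => \sum_(0 <= j < N)
   ip (U (monomial j)) (trunc n (A (monomial j)))) _
   (\sum_(0 <= j < N) ip (U (monomial j)) (A (monomial j)))); [|exact: erefl|].
  move=> n; rewrite /series /=.
  under [RHS]eq_bigr do rewrite ip_trunc.
  rewrite exchange_big /=; apply: eq_bigr => k _.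
  rewrite /trunc (lin_sum lA) ip_sumr; apply: eq_bigr => j _.
  by rewrite (linZ lA) ipZr [ip (monomial j) (V _)]ip_conj VP -ip_conj.
apply: (@cvg_fsum _ (cplx R)) => j.
by apply: cvg_ip; [exact: cvg_cst|exact: cvg_trunc].
Qed.

End TraceClass.

Local Opaque ip.

(** * The amplification of an operator *)

Section SchurProduct.
Context {R : realType}.
Variables (I : Type) (D : I -> I -> R[i]%C) (K : hilbertType R).
Hypothesis D_ge0 : forall (s : seq I) (c : I -> R[i]%C),
  0 <= \sum_(p <- s) \sum_(q <- s) (c p)^* * c q * D p q.

(* Subtracting from every [y q] its component along the first vector splits off
   a nonnegative rank one term and shortens the sum. *)
Lemma schur_product_ge0 (s : seq I) (y : I -> K) :
  0 <= \sum_(p <- s) \sum_(q <- s) D p q * ip (y p) (y q).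
Proof.
elim: s y => [|o s IH] y; first by rewrite big_nil.
pose n : R[i]%C := ip (y o) (y o).
(* If [y o] is 0, division by 0 makes this coefficient 0, and the identities below hold because
   [y o] itself vanishes. *)
pose a q : R[i]%C := ip (y o) (y q) / n.
pose y' q := y q - a q *: y o.
have n0 : 0 <= n by rewrite /n ip_rn lecR sqr_ge0.
have y'o : y' o = 0.
  rewrite /y' /a -/n; have [n00|n00] := eqVneq n 0; last first.
    by rewrite divff // scale1r subrr.
  have -> : y o = 0.
    apply/rn_eq0/eqP; rewrite -sqrf_eq0; apply/eqP.
    by move: n00; rewrite /n ip_rn => /(congr1 (@complex.Re R)).
  by rewrite scaler0 subrr.
have orth q : ip (y o) (y' q) = 0.
  rewrite /y' ipBr ipZr -/n /a; have [n00|n00] := eqVneq n 0; last first.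
    by rewrite divfK // subrr.
  have -> : y o = 0.
    apply/rn_eq0/eqP; rewrite -sqrf_eq0; apply/eqP.
    by move: n00; rewrite /n ip_rn => /(congr1 (@complex.Re R)).
  by rewrite ip0l mul0r mul0r subrr.
have gram p q : ip (y p) (y q) = ip (y' p) (y' q) + n * ((a p)^* * a q).
  have E r : y r = y' r + a r *: y o by rewrite /y' subrK.
  have := orth q; have := orth p; rewrite (E p) (E q).
  move: (y' p) (y' q) (a p) (a q) => u v b c ou ov.
  rewrite ipDl !ipDr !ipZl !ipZr -/n ov (ip_conj (y o) u) ou rmorph0.
  by rewrite !mulr0 addr0 add0r; congr (_ + _); ring.
under eq_bigr do under eq_bigr do rewrite gram mulrDr.
under eq_bigr do rewrite big_split /=.
rewrite big_split /= addr_ge0 //.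
  rewrite big_cons big1 ?add0r; last first.
    by move=> q _; rewrite y'o ip0l mulr0.
  under eq_bigr do rewrite big_cons y'o ip0r mulr0 add0r.
  exact: IH.
rewrite (_ : (\sum_(p <- o :: s) _) = n * \sum_(p <- o :: s)
    \sum_(q <- o :: s) (a p)^* * a q * D p q); first exact: mulr_ge0.
rewrite mulr_sumr; apply: eq_bigr => p _; rewrite mulr_sumr.
by apply: eq_bigr => q _; rewrite mulrCA; congr (_ * _); rewrite mulrC.
Qed.

End SchurProduct.

Section Ampliation.
Context {R : realType}.
Variables (H K : hilbertType R) (T : hilbert_tensor H K).

Lemma ip_tens_sum (s : seq (H * K)) (X : H -> H) :
  ip (\sum_(p <- s) tens T (X p.1) p.2) (\sum_(p <- s) tens T (X p.1) p.2) =
  \sum_(p <- s) \sum_(q <- s) ip (X p.1) (X q.1) * ip p.2 q.2.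
Proof.
rewrite ip_suml; apply: eq_bigr => p _; rewrite ip_sumr.
by apply: eq_bigr => q _; rewrite ip_tens.
Qed.

Lemma tens_sum_dense (u : T) (e : R) : 0 < e ->
  exists s : seq (H * K), rn (u - \sum_(p <- s) tens T p.1 p.2) < e.
Proof.
move=> e0; have : [set: T] u by [].
rewrite -(tens_dense T) => /(_ (ball u e%:C%C)) [|v].
  by apply: nbhsx_ballx; rewrite ltcR.
move=> [[n [x [y ->]]]]; rewrite -ball_normE /ball_ /= rnE ltcR => h.
exists [seq (x i, y i) | i <- enum 'I_n].
by rewrite big_map big_enum.
Qed.

Variables (S : H -> H) (C : R).
Hypotheses (lS : linear S) (C0 : 0 <= C) (hS : op_bound C S).

(** The difference of the squared norms is the sum of D p q <y_p, y_q> with D p q = C^2 <x_p, x_q> -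
    <S x_p, S x_q>. The bound on [S] at linear combinations of the x_p says that D is positive
    semidefinite, so the Schur product with a Gram matrix is nonnegative. *)
Lemma ampl_bound_sum (s : seq (H * K)) :
  rn (\sum_(p <- s) tens T (S p.1) p.2) <= C * rn (\sum_(p <- s) tens T p.1
    p.2).
Proof.
rewrite -(@ler_pXn2r _ 2) ?nnegrE ?mulr_ge0 ?rn_ge0 // -lecR exprMn
  [leRHS]rmorphM /=.
rewrite -!ip_rn ip_tens_sum (ip_tens_sum s id) -subr_ge0 mulr_sumr -sumrB.
rewrite (_ : \sum_(p <- s) _ = \sum_(p <- s) \sum_(q <- s)
   ((C ^+ 2)%:C%C * ip p.1 q.1 - ip (S p.1) (S q.1)) * ip p.2 q.2); last first.
  apply: eq_bigr => p _; rewrite mulr_sumr -sumrB; apply: eq_bigr => q _.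
  by rewrite mulrBl mulrA.
apply: (@schur_product_ge0 _ _ (fun p q =>
  (C ^+ 2)%:C%C * ip p.1 q.1 - ip (S p.1) (S q.1)) K) => {}s c.
pose X := \sum_(p <- s) c p *: p.1.
rewrite (_ : \sum_(p <- s) _ = (C ^+ 2 * rn X ^+ 2 - rn (S X) ^+ 2)%:C%C).
  rewrite lecR subr_ge0 -exprMn ler_pXn2r ?nnegrE ?mulr_ge0 ?rn_ge0 //.
have -> : (C ^+ 2 * rn X ^+ 2 - rn (S X) ^+ 2)%:C%C =
    (C ^+ 2)%:C%C * ip X X - ip (S X) (S X).
  by rewrite !ip_rn [LHS]rmorphB; congr (_ - _); exact: rmorphM.
rewrite /X (lin_sum lS) !ip_suml mulr_sumr -sumrB; apply: eq_bigr => p _.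
rewrite !ip_sumr mulr_sumr -sumrB; apply: eq_bigr => q _.
by rewrite !(linZ lS) !ipZl !ipZr; ring.
Qed.

Lemma amplP : [/\ linear (@ampl _ _ _ T S), op_bound C (@ampl _ _ _ T S) &
  forall x y, ampl S (tens T x y) = tens T (S x) y].
Proof.
pose G (u v : T) := exists s : seq (H * K),
  u = \sum_(p <- s) tens T p.1 p.2 /\ v = \sum_(p <- s) tens T (S p.1) p.2.
have tensZ c x y : tens T (c *: x) y = c *: tens T x y.
  exact: (linZ (tens_linearl T y)).
have [||||W [lW hW WG]] := @linear_relation_extension _ T T G C C0.
- by exists [::]; rewrite !big_nil.
- move=> c _ _ _ _ [s [-> ->]] [s' [-> ->]].
  exists ([seq (c *: p.1, p.2) | p <- s] ++ s').
  rewrite !big_cat !big_map /= !scaler_sumr; split; congr (_ + _).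
    by apply: eq_bigr => p _; rewrite tensZ.
  by apply: eq_bigr => p _; rewrite (linZ lS) tensZ.
- by move=> _ _ [s [-> ->]]; exact: ampl_bound_sum.
- move=> u e /(tens_sum_dense u)[s us].
  by exists (\sum_(p <- s) tens T p.1 p.2), (\sum_(p <- s) tens T (S p.1) p.2);
    split => //; exists s.
have : exists W : T -> T, bounded_op W /\
    forall x y, W (tens T x y) = tens T (S x) y.
  exists W; split.
    apply/bounded_opP; split => //; exists (C + 1); first by rewrite
      (lt_le_trans ltr01) // lerDr.
    by move=> u; apply: le_trans (hW u) _; rewrite ler_wpM2r ?rn_ge0 // lerDl.
  by move=> x y; apply: WG; exists [:: (x, y)]; rewrite !big_seq1.
move=> /(@xgetPex _ (cst 0)); rewrite -/(@ampl _ _ _ T S).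
move: (@ampl _ _ _ T S) => A [/bounded_opP[lA [M M0 hA]] AT].
(* The operator selected by [xget] comes with some bound [M] of its own. It agrees with the
   ampliation on sums of tensors, where the bound is [C], and density carries [C] over to all
   vectors; an approximation error d costs (M + C) d. *)
split => // u; apply/ler_addgt0Pr => e e0.
have MC : 0 < M + C by rewrite ltr_pwDl.
have [s us] := tens_sum_dense u (divr_gt0 e0 MC).
have := ampl_bound_sum s; move: us.
set v := \sum_(p <- s) tens T p.1 p.2 => us.
have <- : A v = \sum_(p <- s) tens T (S p.1) p.2.
  by rewrite (lin_sum lA); apply: eq_bigr => p _; exact: AT.
move=> Av; have h1 := rnD (A (u - v)) (A v).
rewrite -(linD lA) subrK in h1.
have h2 : M * rn (u - v) <= M * (e / (M + C)) by rewrite ler_pM2l // ltW.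
have h3 : C * rn v <= C * (rn u + e / (M + C)).
  rewrite ler_wpM2l //; have := rnD u (v - u).
  by rewrite addrC subrK rnBC; lra.
have := hA (u - v).
have -> : e = M * (e / (M + C)) + C * (e / (M + C)).
  by rewrite -mulrDl mulrC divfK // gt_eqF.
rewrite mulrDr in h3; lra.
Qed.

End Ampliation.

(** * The channel *)

Section Channel.
Context {R : realType}.
Variables (f : cplx R -> cplx R).
Hypothesis f_disk : forall z, disk z -> disk (f z).
Variables (Hf : rkhs disk (dbr_kernel f)) (T : hilbert_tensor (hardy R) Hf).
Variables (V : hardy R -> T) (k : cplx R -> hardy R).
Hypothesis V_isometry : linear_isometry V.
Hypothesis Vk : forall w, disk w -> V (k w) = tens T (k (f w)) (rk_ker Hf w).

Local Notation Phi := (dbr_channel V).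

Let lV : linear V. Proof. exact: V_isometry.1. Qed.

Let V1 : op_bound 1 V.
Proof. by move=> h; rewrite mul1r -lecR -!rnE V_isometry.2. Qed.

Lemma dbr_channel_bounded S (C : R) : linear S -> 0 <= C -> op_bound C S ->
  linear (Phi S) /\ op_bound C (Phi S).
Proof.
move=> lS C0 hS; have [lA hA _] := amplP T lS C0 hS.
have lV' := adjoint_linear lV ler01 V1; have V1' := adjoint_bound lV ler01 V1.
split; first by apply: linear_comp => //; exact: linear_comp.
move=> h; apply: le_trans (V1' _) _; rewrite mul1r.
apply: le_trans (hA _) _; rewrite ler_wpM2l //.
by apply: le_trans (V1 _) _; rewrite mul1r.
Qed.

Lemma iter_dbr_channel_bounded n S (C : R) :
  linear S -> 0 <= C -> op_bound C S ->
  linear (iter n Phi S) /\ op_bound C (iter n Phi S).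
Proof.
move=> lS C0 hS; elim: n => [//|n [lI hI]]; exact: dbr_channel_bounded.
Qed.

Lemma bounded_op_dbr_channel S : bounded_op S -> bounded_op (Phi S).
Proof.
move=> /bounded_opP[lS [C C0 hS]].
have [lP hP] := dbr_channel_bounded lS (ltW C0) hS.
by apply/bounded_opP; split => //; exists C.
Qed.

Lemma dbr_channel_kernel S (C : R) z w : linear S -> 0 <= C -> op_bound C S ->
  disk z -> disk w ->
  ip (k z) (Phi S (k w)) =
  ip (k (f z)) (S (k (f w))) * dbr_kernel f z w.
Proof.
move=> lS C0 hS z1 w1; have [_ _ AT] := amplP T lS C0 hS.
rewrite [LHS](adjointPr lV ler01 V1).
rewrite (Vk z1) (Vk w1) AT ip_tens; congr (_ * _).
by rewrite -(rk_reproducing _ z1) rk_kerE.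
Qed.

Lemma iter_disk n z : disk z -> disk (iter n f z).
Proof. by move=> z1; elim: n => [//|n IH]; exact: f_disk. Qed.

(** Peeling off the outermost channel moves the induction hypothesis to the pair [f z], [f w]; its
    denominator there cancels the numerator of [dbr_kernel f z w] and is nonzero since both points
    lie in the disk. *)
Lemma iter_dbr_channel_kernel n S (C : R) z w :
  linear S -> 0 <= C -> op_bound C S -> disk z -> disk w ->
  ip (k z) (iter n Phi S (k w)) =
  ip (k (iter n f z)) (S (k (iter n f w))) *
  ((1 - iter n f z * (iter n f w)^*) / (1 - z * w^*)).
Proof.
move=> lS C0 hS; elim: n z w => [|n IH] z w z1 w1.
  by rewrite divff ?mulr1 //; exact: one_sub_neq0.
have [lI hI] := iter_dbr_channel_bounded n lS C0 hS.
rewrite iterS (dbr_channel_kernel lI C0 hI z1 w1).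
rewrite (IH _ _ (f_disk z1) (f_disk w1)) -(iterSr n f z) -(iterSr n f w).
rewrite -mulrA; congr (_ * _).
rewrite /dbr_kernel mulrA; congr (_ / _).
by rewrite divfK //; exact: (one_sub_neq0 (f_disk z1) (f_disk w1)).
Qed.

End Channel.

(** * Weak convergence uniform over a ball of operators *)

Section UniformFilter.
Variable X : Type.

(* With [X] a ball of operators, convergence of traces along this filter is
   uniform over the ball, which is what convergence in trace norm requires. *)
Definition unif_oo : set_system (nat * X) :=
  [set A | \forall n \near \oo, forall s, A (n, s)].

(** Properness needs an inhabitant: over an empty [X] the empty set would belong to the filter. For
    a ball of operators the zero operator serves. *)
Lemma unif_oo_filter : X -> ProperFilter unif_oo.
Proof.
move=> x; apply: Build_ProperFilter_ex => [A|].
  by move=> [N _ /(_ N (leqnn N))/(_ x)]; exists (N, x).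
split.
- by exists 0.
- move=> A B hA hB; apply: (@filterS2 _ \oo _ _ _ _ _ hA hB) => n h1 h2 s.
  by split.
- by move=> A B AB hA; apply: (@filterS _ \oo _ _ _ _ hA) => n h s; exact/AB/h.
Qed.

Lemma unif_oo_fst (R : realType) (b : nat -> R) (l : R) (x : X) :
  b n @[n --> \oo] --> l -> b p.1 @[p --> unif_oo] --> l.
Proof.
have FF := unif_oo_filter x.
move=> /cvgrPdist_le bl; apply/cvgrPdist_le => e e0.
by apply: (@filterS _ \oo _ _ _ _ (bl e e0)) => n h s; exact: h.
Qed.

Lemma unif_oo_dist_le (R : realType) (b : nat * X -> R) (l e : R) (x : X) :
  b p @[p --> unif_oo] --> l -> 0 < e ->
  \forall n \near \oo, forall s, `|l - b (n, s)| <= e.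
Proof.
have FF := unif_oo_filter x.
by move=> /cvgrPdist_le bl e0; exact: bl e e0.
Qed.

Lemma cvg_unif_oo (R : realType) (b : nat * X -> R) (l : R) (x : X) :
  b p @[p --> unif_oo] --> l -> b (n, x) @[n --> \oo] --> l.
Proof.
move=> bl; apply/cvgrPdist_le => e e0.
by apply: (@filterS _ \oo _ _ _ _ (unif_oo_dist_le x bl e0)) => n h; exact: h.
Qed.

End UniformFilter.

Lemma cvgr0_approx (R : realType) (T : Type) (F : set_system T)
    {FF : Filter F} (b : T -> R) : (forall p, 0 <= b p) ->
  (forall e : R, 0 < e -> exists2 b' : T -> R,
    b' p @[p --> F] --> (0 : R) & forall p, b p <= b' p + e) ->
  b p @[p --> F] --> (0 : R).
Proof.
move=> b0 bb'; apply/cvgrPdist_le => e e0.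
have e20 : 0 < e / 2 by rewrite divr_gt0.
have [b' /cvgrPdist_le/(_ _ e20) b'0 bb] := bb' _ e20.
apply: (@filterS _ F FF _ _ _ b'0) => p.
rewrite !sub0r !normrN (ger0_norm (b0 p)) => hp.
have := bb p; have := ler_norm (b' p); lra.
Qed.

Section Convergence.
Context {R : realType}.
Variables (f : cplx R -> cplx R) (a : cplx R).
Hypotheses (f_disk : forall z, disk z -> disk (f z)) (a_disk : disk a).
Hypothesis f_cvg : forall z, disk z -> iter n f z @[n --> \oo] --> a.
Variables (Hf : rkhs disk (dbr_kernel f)) (T : hilbert_tensor (hardy R) Hf).
Variables (V : hardy R -> T) (k : cplx R -> hardy R).
Hypothesis V_isometry : linear_isometry V.
Hypothesis Vk : forall w, disk w -> V (k w) = tens T (k (f w)) (rk_ker Hf w).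
Hypothesis k_cvg : forall z, disk z -> k (iter n f z) @[n --> \oo] --> k a.
Hypothesis ip_k : forall z w, disk z -> disk w ->
  ip (k z) (k w) = (1 - z * w^*)^-1.
Hypothesis k_total : forall N : hardy R -> Prop,
  (forall w, disk w -> N (k w)) -> N 0 ->
  (forall c g h, N g -> N h -> N (c *: g + h)) ->
  (forall h, (forall e : R, 0 < e -> exists2 g, N g & rn (h - g) < e) -> N h) ->
  forall h, N h.

Local Notation Phi := (dbr_channel V).

Variable C : R.
Hypothesis C0 : 0 <= C.

Definition ball_op := {S : hardy R -> hardy R | linear S /\ op_bound C S}.

Implicit Types (p : nat * ball_op) (x y : hardy R).

(** The normalized vector is written out because [k] is abstract here; for [k] equal to [szego] it
    is [unit_szego a]. *)
Definition kernel_state (S : hardy R -> hardy R) : R[i]%C :=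
  ip (`|k a|^-1 *: k a) (S (`|k a|^-1 *: k a)).

Definition defect p y : hardy R :=
  iter p.1 Phi (sval p.2) y - kernel_state (sval p.2) *: y.

(** The Gram formula on the diagonal gives |k_a|^2 = 1/(1 - |a|^2), so the normalization is exactly
    the limit of the numerators in [iter_dbr_channel_kernel]. *)
Lemma kernel_stateE S : linear S ->
  kernel_state S = ip (k a) (S (k a)) * (1 - a * a^*).
Proof.
move=> lS; rewrite /kernel_state (linZ lS) ipZl ipZr mulrA mulrC.
congr (_ * _); apply: (can_inj (@invrK _)).
rewrite -(ip_k a_disk a_disk) ip_rn rnE -fmorphV conjC_rc -rmorphM -fmorphV.
by rewrite -expr2 exprVn invrK.
Qed.

Lemma ka_neq0 : rn (k a) != 0.
Proof.
apply/eqP => /rn_eq0 ka0; have := ip_k a_disk a_disk.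
rewrite ka0 ip0l => /esym/eqP; rewrite invr_eq0.
by apply/negP; exact: one_sub_neq0.
Qed.

Lemma rn_kernel_state p : rn (kernel_state (sval p.2) : R[i]%C) <= C.
Proof.
have [lS hS] := svalP p.2; rewrite /kernel_state.
set e := `|k a|^-1 *: k a.
have e1 : rn e = 1.
  by rewrite /e rnE -fmorphV rnZ rn_real ger0_norm ?invr_ge0 ?rn_ge0 // mulVf
    ?ka_neq0.
apply: le_trans (ip_le_rn _ _) _; rewrite e1 mul1r.
by apply: le_trans (hS _) _; rewrite e1 mulr1.
Qed.

Lemma defect_linear p : linear (defect p).
Proof.
have [lS hS] := svalP p.2.
have [lI _] := iter_dbr_channel_bounded V_isometry p.1 lS C0 hS.
move=> c x y; rewrite /defect lI scalerBr scalerDr !scalerA.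
by rewrite (mulrC c) opprD addrACA.
Qed.

Lemma defect_bound p : op_bound (2 * C) (defect p).
Proof.
have [lS hS] := svalP p.2.
have [_ hI] := iter_dbr_channel_bounded V_isometry p.1 lS C0 hS.
move=> y; rewrite /defect; apply: le_trans (rnB _ _) _.
rewrite -mulrA mulr_natl mulr2n; apply: lerD; first exact: hI.
by rewrite rnZ ler_wpM2r ?rn_ge0 //; exact: rn_kernel_state.
Qed.

Lemma rn_ip_defect p x y : rn (ip x (defect p y)) <= rn x * (2 * C * rn y).
Proof.
by apply: le_trans (ip_le_rn _ _) _; rewrite ler_wpM2l ?rn_ge0 //; exact:
  defect_bound.
Qed.

Definition vanishes x y :=
  rn (ip x (defect p y)) @[p --> @unif_oo ball_op] --> (0 : R).

Lemma ball_op0 : linear (cst 0 : hardy R -> hardy R) /\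
  op_bound C (cst 0 : hardy R -> hardy R).
Proof.
split=> [c x y|x]; first by rewrite /cst scaler0 addr0.
by rewrite /cst rn0 mulr_ge0 ?rn_ge0.
Qed.

Definition zero_op : ball_op := exist _ _ ball_op0.

Instance unif_oo_ball_op : ProperFilter (@unif_oo ball_op).
Proof. exact: unif_oo_filter zero_op. Qed.

Lemma vanishes_le x y (b : nat * ball_op -> R) :
  (forall p, rn (ip x (defect p y)) <= b p) ->
  b p @[p --> @unif_oo ball_op] --> (0 : R) -> vanishes x y.
Proof.
move=> xb b0; apply: squeeze_cvgr b0; last exact: cvg_cst.
by apply: nearW => p; rewrite rn_ge0; exact: xb.
Qed.

Lemma vanishes_linr x c y y' :
  vanishes x y -> vanishes x y' -> vanishes x (c *: y + y').
Proof.
move=> xy xy'; apply: (@vanishes_le _ _ (fun p =>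
  rn c * rn (ip x (defect p y)) + rn (ip x (defect p y')))).
  by move=> p; rewrite defect_linear ipDr ipZr -rnM rnD.
rewrite -[X in _ --> X](addr0 0) -{1}(mulr0 (rn c)).
by apply: cvgD; [apply: cvgM; [exact: cvg_cst|exact: xy]|exact: xy'].
Qed.

Lemma vanishes_linl c x x' y :
  vanishes x y -> vanishes x' y -> vanishes (c *: x + x') y.
Proof.
move=> xy xy'; apply: (@vanishes_le _ _ (fun p =>
  rn c * rn (ip x (defect p y)) + rn (ip x' (defect p y)))).
  by move=> p; rewrite ipDl ipZl -(rn_conj c) -rnM rnD.
rewrite -[X in _ --> X](addr0 0) -{1}(mulr0 (rn c)).
by apply: cvgD; [apply: cvgM; [exact: cvg_cst|exact: xy]|exact: xy'].
Qed.

(** The bound 2C on the defect holds for all [p] at once, so replacing [y] by a nearby vector costs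
    an error uniform in [n] and in the operator. *)
Lemma vanishes_closedr x y :
  (forall e : R, 0 < e -> exists2 y', vanishes x y' & rn (y - y') < e) ->
  vanishes x y.
Proof.
move=> xy; apply: cvgr0_approx => [p|e e0]; first exact: rn_ge0.
have D0 : 0 <= rn x * (2 * C) by rewrite mulr_ge0 ?rn_ge0 // mulr_ge0.
have D1 : 0 < rn x * (2 * C) + 1 by lra.
have [y' xy' yy'] := xy _ (divr_gt0 e0 D1).
exists (fun p => rn (ip x (defect p y'))) => // p.
rewrite -{1}(subrK y' y) (linD (defect_linear p)) ipDr addrC.
apply: le_trans (rnD _ _) _; rewrite lerD2l.
apply: le_trans (rn_ip_defect _ _ _) _; rewrite mulrA.
apply: (@le_trans _ _ (rn x * (2 * C) * (e / (rn x * (2 * C) + 1)))).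
  by rewrite ler_wpM2l // ltW.
by rewrite mulrCA ger_pMr // ler_pdivrMr // mul1r lerDl.
Qed.

Lemma vanishes_closedl x y :
  (forall e : R, 0 < e -> exists2 x', vanishes x' y & rn (x - x') < e) ->
  vanishes x y.
Proof.
move=> xy; apply: cvgr0_approx => [p|e e0]; first exact: rn_ge0.
have D0 : 0 <= 2 * C * rn y by rewrite mulr_ge0 ?rn_ge0 // mulr_ge0.
have D1 : 0 < 2 * C * rn y + 1 by lra.
have [x' xy' xx'] := xy _ (divr_gt0 e0 D1).
exists (fun p => rn (ip x' (defect p y))) => // p.
rewrite -{1}(subrK x' x) ipDl addrC.
apply: le_trans (rnD _ _) _; rewrite lerD2l.
apply: le_trans (rn_ip_defect _ _ _) _; rewrite mulrC.
apply: (@le_trans _ _ (2 * C * rn y * (e / (2 * C * rn y + 1)))).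
  by rewrite ler_wpM2l // ltW.
by rewrite mulrCA ger_pMr // ler_pdivrMr // mul1r lerDl.
Qed.

Lemma vanishes0r x : vanishes x 0.
Proof.
apply: (@vanishes_le _ _ (cst 0)); last exact: cvg_cst.
by move=> p; rewrite (lin0 (defect_linear p)) ip0r rn0.
Qed.

Lemma vanishes0l y : vanishes 0 y.
Proof.
apply: (@vanishes_le _ _ (cst 0)); last exact: cvg_cst.
by move=> p; rewrite ip0l rn0.
Qed.

Lemma vanishes_kernel z w : disk z -> disk w -> vanishes (k z) (k w).
Proof.
move=> z1 w1.
pose u n := k (iter n f z); pose v n := k (iter n f w).
pose q : R[i]%C := (1 - z * w^*)^-1.
pose dz n : cplx R := iter n f z * (iter n f w)^*.
have dzc : dz n @[n --> \oo] --> (a * a^* : cplx R).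
  by apply: cvg_mulc (f_cvg z1) _; apply: cvg_conj; exact: f_cvg w1.
(* Three errors are added: the numerator, the left kernel and the right kernel are each replaced by
   their limits. The operator enters only through its bound [C], so [b] depends on [n] alone. *)
pose b n := C * (rn (u n) * rn (v n)) * (rn (dz n - a * a^*) * rn q) +
  C * (rn (u n - k a) * rn (v n) + rn (k a) * rn (v n - k a)) *
  rn ((1 - a * a^*) * q).
have b0 : b n @[n --> \oo] --> (0 : R).
  have /cvg_rnP d0 := dzc.
  have /cvg_rnP u0 := k_cvg z1; have /cvg_rnP v0 := k_cvg w1.
  have uc := cvg_rn (k_cvg z1); have vc := cvg_rn (k_cvg w1).
  rewrite (_ : 0 = C * (rn (k a) * rn (k a)) * (0 * rn q) +
    C * (0 * rn (k a) + rn (k a) * 0) * rn ((1 - a * a^*) * q)); last by ring.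
  apply: cvgD; apply: cvgM; try exact: cvg_cst.
  - by apply: cvgM; [exact: cvg_cst|apply: cvgM; [exact: uc|exact: vc]].
  - by apply: cvgM; [exact: d0|exact: cvg_cst].
  - apply: cvgM; first exact: cvg_cst.
    apply: cvgD; apply: cvgM; try exact: cvg_cst.
    + exact: u0.
    + exact: vc.
    + exact: v0.
apply: (@vanishes_le _ _ (fun p => b p.1)); last exact: unif_oo_fst zero_op b0.
move=> [n [S [lS hS]]]; rewrite /defect /= ipBr ipZr.
rewrite (iter_dbr_channel_kernel f_disk V_isometry Vk n lS C0 hS z1 w1).
rewrite (kernel_stateE lS) (ip_k z1 w1) -/q -/(u n) -/(v n) -/(dz n).
have -> : ip (u n) (S (v n)) * ((1 - dz n) * q) -
    ip (k a) (S (k a)) * (1 - a * a^*) * q =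
  ip (u n) (S (v n)) * (- (dz n - a * a^*) * q) +
  (ip (u n - k a) (S (v n)) + ip (k a) (S (v n - k a))) * ((1 - a * a^*) * q).
  rewrite (linB lS) ipBl ipBr; ring.
apply: le_trans (rnD _ _) _; rewrite /b !rnM rnN.
apply: lerD.
  rewrite ler_wpM2r ?mulr_ge0 ?rn_ge0 //.
  apply: le_trans (ip_le_rn _ _) _; rewrite mulrCA.
  by rewrite ler_wpM2l ?rn_ge0 //; exact: hS.
rewrite ler_wpM2r ?mulr_ge0 ?rn_ge0 // mulrDr.
apply: le_trans (rnD _ _) _; apply: lerD.
  apply: le_trans (ip_le_rn _ _) _; rewrite mulrCA.
  by rewrite ler_wpM2l ?rn_ge0 //; exact: hS.
apply: le_trans (ip_le_rn _ _) _; rewrite mulrCA.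
by rewrite ler_wpM2l ?rn_ge0 //; exact: hS.
Qed.

Lemma vanishes_all x y : vanishes x y.
Proof.
apply: (@k_total (fun x => vanishes x y)) => [z z1||c g h|h]; last first.
- exact: vanishes_closedl.
- exact: vanishes_linl.
- exact: vanishes0l.
apply: (@k_total (fun y => vanishes (k z) y)) => [w w1||c g h|h].
- exact: vanishes_kernel.
- exact: vanishes0r.
- exact: vanishes_linr.
- exact: vanishes_closedr.
Qed.

(** The difference is the series of <y_j, defect p x_j>. Each term tends to 0 along the uniform
    filter and the majorant is independent of [p], so Tannery's theorem keeps the uniformity over
    the ball. *)
Lemma trace_channel_vanishes rho : trace_class rho ->
  rn (trace (rho \o iter p.1 Phi (sval p.2)) -
      kernel_state (sval p.2) * trace rho : cplx R)
    @[p --> @unif_oo ball_op] --> (0 : R).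
Proof.
move=> /trace_class_nuclear[x [y nu]].
have C20 : 0 <= 2 * C by rewrite mulr_ge0.
pose ct p := kernel_state (sval p.2).
have lid : linear (id : hardy R -> hardy R) by [].
have hid : op_bound 1 (id : hardy R -> hardy R) by move=> h; rewrite mul1r.
have [c1 t1] := nuclear_trace nu ler01 lid hid.
have [] := @series_dominated_cvg _ _ _ unif_oo_ball_op
  (fun p j => ip (y j) (defect p (x j)))
  (fun p => trace (rho \o iter p.1 Phi (sval p.2)) - ct p * trace rho : cplx R)
  (cst 0) (fun j => 2 * C * (rn (x j) ^+ 2 + rn (y j) ^+ 2)).
- by apply: nearW => p j; apply: rn_ip_mul_le => //; exact: defect_bound.
- apply: nearW => p; have [lS hS] := svalP p.2.
  have [lI hI] := iter_dbr_channel_bounded V_isometry p.1 lS C0 hS.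
  have [c2 t2] := nuclear_trace nu C0 lI hI.
  rewrite (has_traceE t2) (has_traceE t1).
  apply: (@cvg_congr _ _ _ _ (fun n =>
    series (fun j => ip (y j) (iter p.1 Phi (sval p.2) (x j)) : cplx R) n -
    ct p *: series (fun j => ip (y j) (x j) : cplx R) n) _
    (limn (series (fun j => ip (y j) (iter p.1 Phi (sval p.2) (x j)) : cplx R))
      -
     ct p *: limn (series (fun j => ip (y j) (x j) : cplx R)))).
  + move=> n; rewrite /series /= scaler_sumr -sumrB; apply: eq_bigr => j _.
    by rewrite ipBr ipZr.
  + exact: erefl.
  + by apply: cvgB; [exact: c2|apply: cvgZl_tmp; exact: c1].
- exact: nuclear_bound_cvg nu.
- by move=> j; apply/cvg_rnP; under eq_fun do rewrite subr0; exact: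
  vanishes_all.
move=> c3 t3.
have E : limn (series (cst 0 : nat -> cplx R)) = 0.
  apply: (cvg_lim (@norm_hausdorff _ _)).
  rewrite (_ : series _ = cst 0); first exact: cvg_cst.
  by apply/funext => n; rewrite /series /= big1.
have /cvg_rnP := t3; rewrite E.
rewrite (_ : (fun p => rn (_ - 0)) = (fun p =>
  rn (trace (rho \o iter p.1 Phi (sval p.2)) - ct p * trace rho : cplx R))) //.
by apply/funext => p; rewrite subr0.
Qed.

End Convergence.

(** * From traces to the ultraweak topology and the trace norm *)

Section TraceLimits.
Context {R : realType}.
Variables (Phi : (hardy R -> hardy R) -> hardy R -> hardy R) (e : hardy R).
Hypothesis Phi_bounded : forall S, bounded_op S -> bounded_op (Phi S).
Hypothesis trace_vanishes : forall (C : R), 0 <= C -> forall rho,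
  trace_class rho ->
  rn (trace (rho \o iter p.1 Phi (sval p.2)) -
      ip e (sval p.2 e) * trace rho : cplx R)
    @[p --> @unif_oo (ball_op C)] --> (0 : R).

Lemma trace_class_has_trace (rho : hardy R -> hardy R) S : trace_class rho ->
  bounded_op S -> has_trace (rho \o S) (trace (rho \o S)).
Proof.
move=> /trace_class_nuclear[x [y nu]] /bounded_opP[lS [C C0 hS]].
have [_ t] := nuclear_trace nu (ltW C0) lS hS.
by rewrite (has_traceE t).
Qed.

Lemma trace_class_has_trace_id (rho : hardy R -> hardy R) :
  trace_class rho -> has_trace rho (trace rho).
Proof.
move=> trho; apply: (@trace_class_has_trace rho id trho); split => // x.
exact: cvg_id.
Qed.

Lemma trace_scale (rho : hardy R -> hardy R) (c : R[i]%C) :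
  trace_class rho -> trace (rho \o (fun h => c *: h)) = c * trace rho.
Proof.
move=> trho; have t := trace_class_has_trace_id trho.
apply: has_traceE; apply: (@cvg_congr _ _ _ _ (fun n =>
  c *: series (fun n => ip (monomial n) (rho (monomial n)) : cplx R) n) _
  (c *: (trace rho : cplx R))).
- move=> n; rewrite /series /= scaler_sumr; apply: eq_bigr => k _.
  by rewrite (linZ trho.1.1) ipZr.
- exact: erefl.
- by apply: cvgZl_tmp; exact: t.
Qed.

Lemma ultraweak_limit S : bounded_op S ->
  ultraweakly (fun n => iter n Phi S) (fun h => ip e (S e) *: h).
Proof.
move=> /bounded_opP[lS [C C0 hS]] rho trho.
pose s : ball_op C := exist _ S (conj lS hS).
have h := cvg_unif_oo s (trace_vanishes (ltW C0) trho).
rewrite (trace_scale _ trho); apply/cvg_rnP; exact: h.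
Qed.

Lemma ketbra_bounded (u v : hardy R) : bounded_op (ketbra u v).
Proof.
apply/bounded_opP; split=> [c x y|].
  by rewrite /ketbra ip_linear scalerDl scalerA.
exists (rn v * rn u + 1) => [|h].
  by rewrite ltr_wpDl // mulr_ge0 ?rn_ge0.
rewrite /ketbra rnZ mulrDl mul1r; apply: le_trans (_ : _ <= rn v * rn u * rn h)
  _.
  by rewrite mulrAC ler_wpM2r ?rn_ge0 //; exact: ip_le_rn.
by rewrite lerDl rn_ge0.
Qed.

Lemma bounded_opB (A B : hardy R -> hardy R) (c : R[i]%C) :
  bounded_op A -> bounded_op B -> bounded_op (fun h => A h - c *: B h).
Proof.
move=> /bounded_opP[lA [M M0 hA]] /bounded_opP[lB [N N0 hB]].
apply/bounded_opP; split=> [b x y|].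
  by rewrite lA lB scalerBr scalerDr !scalerA (mulrC b) opprD addrACA.
exists (M + rn c * N) => [|h].
  by rewrite ltr_pwDl // mulr_ge0 ?rn_ge0 // ltW.
apply: le_trans (rnB _ _) _; rewrite mulrDl rnZ -mulrA.
by apply: lerD; [exact: hA|rewrite ler_wpM2l ?rn_ge0 //; exact: hB].
Qed.

Variable Psi : (hardy R -> hardy R) -> hardy R -> hardy R.
Hypothesis preadj : is_preadjoint Phi Psi.

Lemma iter_preadjoint n rho S : trace_class rho -> bounded_op S ->
  trace_class (iter n Psi rho) /\
  trace (iter n Psi rho \o S) = trace (rho \o iter n Phi S).
Proof.
move=> trho; elim: n S => [//|n IH] S bS.
have [tn E] := IH _ (Phi_bounded bS); have [tn1 E1] := preadj tn.
rewrite iterS; split => //.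
by rewrite E1 // E iterSr.
Qed.

Lemma trace_norm_limit rho : trace_class rho ->
  trace_norm (iter n Psi rho - trace rho *: ketbra e e) @[n --> \oo] --> 0%E.
Proof.
move=> trho.
pose A n h := iter n Psi rho h - trace rho *: ketbra e e h.
rewrite (_ : (fun n => _) = (fun n => trace_norm (A n))) //.
have bid : bounded_op (id : hardy R -> hardy R).
  by split => // x; exact: cvg_id.
have bA n : bounded_op (A n).
  apply: bounded_opB; last exact: ketbra_bounded.
  by have [[]] := iter_preadjoint n trho bid.
have A0 n : (0 <= trace_norm (A n))%E.
  by apply: nneseries_ge0 => j _ _; exact: op_abs_monomial_ge0.
have Ale (eps : R) : 0 < eps ->
    \forall n \near \oo, (trace_norm (A n) <= eps%:E)%E.
  move=> eps0; have h0 := unif_oo_dist_le (zero_op ler01)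
    (trace_vanishes ler01 trho) eps0.
  apply: (@filterS _ \oo _ _ _ _ h0) => n h; apply: trace_norm_le => // S lS hS.
  have bS : bounded_op S by apply/bounded_opP; split => //; exists 1.
  have := h (exist _ S (conj lS hS)).
  rewrite /= sub0r normrN ger0_norm ?rn_ge0 //.
  have [tn <-] := iter_preadjoint n trho bS.
  have t1 := trace_class_has_trace tn bS.
  have t2 := @has_trace_ketbra _ e e _ _ lS hS.
  have t3 : has_trace (A n \o S) (trace (iter n Psi rho \o S) -
      trace rho * ip e (S e)) by exact: has_traceB t1 t2.
  by rewrite (has_traceE t3) mulrC.
(* The trace norm takes extended real values; the bound with epsilon equal to 1 shows that it is
   eventually finite. *)
apply/fine_cvgP; split.
  apply: (@filterS _ \oo _ _ _ _ (Ale 1 ltr01)) => n An.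
  by rewrite ge0_fin_numE // (le_lt_trans An) // ltry.
apply/cvgrPdist_le => eps eps0; apply: (@filterS _ \oo _ _ _ _ (Ale _ eps0)).
move=> n An; rewrite sub0r normrN /= ger0_norm ?fine_ge0 //.
rewrite -lee_fin fineK // ge0_fin_numE // (le_lt_trans An) // ltry //.
Qed.

End TraceLimits.

Theorem theorem5p2 (R : realType) (f : cplx R -> cplx R) (a : cplx R)
    (f_disk : forall z, disk z -> disk (f z))
    (f_holomorphic : forall z, disk z -> derivable f z 1)
    (a_disk : disk a)
    (f_cvg : locally_uniformly disk (fun n => iter n f) (cst a))
    (Hf : rkhs disk (dbr_kernel f))
    (T : hilbert_tensor (hardy R) Hf)
    (V : hardy R -> T) (V_dbr : is_dbr_isometry V) :
  (forall Psi, is_preadjoint (dbr_channel V) Psi ->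
     forall rho, trace_class rho ->
       trace_norm (iter n Psi rho -
                   trace rho *: ketbra (unit_szego a) (unit_szego a))
         @[n --> \oo] --> 0%E) /\
  (forall S, bounded_op S ->
     ultraweakly (fun n => iter n (dbr_channel V) S)
       (fun h => ip (unit_szego a) (S (unit_szego a)) *: h)).
Proof.
have f_ptws z : disk z -> iter n f z @[n --> \oo] --> a.
  move=> z1; have [U Uz fU] := f_cvg z z1.
  (* Restricting uniform convergence to a singleton yields convergence of the orbit of [z]. *)
  have zU : [set z] `<=` U `&` disk.
    by move=> _ ->; split => //; exact: nbhs_singleton.
  by have := uniform_subset_cvg _ zU fU; rewrite uniform_set1; apply.
have vanish (C : R) : 0 <= C -> forall rho, trace_class rho ->
    rn (trace (rho \o iter p.1 (dbr_channel V) (sval p.2)) -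
        ip (unit_szego a) (sval p.2 (unit_szego a)) * trace rho : cplx R)
      @[p --> @unif_oo (ball_op C)] --> (0 : R).
  (* The abstract kernel family is instantiated by [szego]: continuity along orbits, the Gram
     formula and totality are the three facts about it supplied here, next to the intertwining
     relation in [V_dbr]. *)
  exact: (trace_channel_vanishes f_disk a_disk f_ptws V_dbr.1 V_dbr.2
  (fun z z1 => cvg_szego (fun n => iter_disk f_disk n z1) a_disk (f_ptws z z1))
  (@ip_szego R) (@szego_closed_subspace R)).
have bPhi := bounded_op_dbr_channel V_dbr.1.
split=> [Psi preadj rho trho|S bS].
  exact: (trace_norm_limit bPhi vanish preadj trho).
exact: (ultraweak_limit vanish bS).
Qed.
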